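(* Let $\alpha\in(0,1)$, let $f$ be a log-concave density on $\mathbb{R}$, let $X_1,\dots,X_n$ be i.i.d. with density $f$, and let $x_1<\dots<x_m$, the set of densities $\tilde{\mathcal{C}}_n(\alpha)$ and the constraints (C1)-(C4) be as defined in the context. Then $$\mathbb{P}_f\{f\in\tilde{\mathcal{C}}_n(\alpha)\}\ \ge\ 1-\alpha .$$ Consequently, if for $i=1,\dots,m$ one defines $$\hat\ell(x_i):=\inf \ell_i,\qquad \hat\mu(x_i):=\sup\ell_i,$$ the infimum and supremum being over all $(\boldsymbol\ell,\boldsymbol g)\in\mathbb{R}^m\times\mathbb{R}^{m-1}$ satisfying (C1)-(C4) (equivalently, over the values $\ell_i=\log h(x_i)$ for $h\in\tilde{\mathcal{C}}_n(\alpha)$), then $$\mathbb{P}_f\Bigl\{\exp(\hat\ell(x_i))\le f(x_i)\le\exp(\hat\mu(x_i))\ \text{ for all } i=1,\dots,m\Bigr\}\ \ge\ 1-\alpha .$$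
   Context: A function $f:\mathbb{R}\to[0,\infty)$ is log-concave if $f=\exp\phi$ with $\phi:\mathbb{R}\to[-\infty,\infty)$ concave. $\log$ is the natural logarithm, $\log_2$ the base-2 logarithm. $X_{(j)}$ is the $j$th order statistic of the sample. Conventions: $\inf\emptyset=+\infty$, $\sup\emptyset=-\infty$, $\exp(-\infty)=0$, $\exp(+\infty)=+\infty$. Definitions. $s_n:=\lceil\log_2\log n\rceil$; $m:=\lfloor (n-1)/2^{s_n}\rfloor+1$; $x_i:=X_{(1+(i-1)2^{s_n})}$ for $i=1,\dots,m$ (almost surely $x_1<\dots<x_m$). $B_{max}:=\lfloor\log_2(n/8)\rfloor-s_n$; $n$ is assumed such that $B_{max}\ge 0$ (so $m\ge 8$). For $B=0,\dots,B_{max}$: $n_B:=\lfloor (n-1)/2^{B+s_n}\rfloor$ and $\mathcal{I}_B:=\{(j,k): j=1+(i-1)2^B,\ k=1+i2^B,\ i=1,\dots,n_B\}$. $t_n:=\sum_{B=0}^{B_{max}}\frac1{B+2}$. With $\mathrm{qBeta}(\gamma,r,s)$ the $\gamma$-quantile of the Beta$(r,s)$ distribution, $$c_B:=\mathrm{qBeta}\Bigl(\tfrac{\alpha}{2(B+2)n_Bt_n},2^{B+s_n},n+1-2^{B+s_n}\Bigr),\quad d_B:=\mathrm{qBeta}\Bigl(1-\tfrac{\alpha}{2(B+2)n_Bt_n},2^{B+s_n},n+1-2^{B+s_n}\Bigr).$$ $E(s):=\int_0^1 e^{st}\,dt$. For $\boldsymbol\ell=(\ell_1,\dots,\ell_m)\in\mathbb{R}^m$,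 $\boldsymbol g=(g_1,\dots,g_{m-1})\in\mathbb{R}^{m-1}$ and $i=1,\dots,m-1$: $L_i:=(x_{i+1}-x_i)e^{\ell_i}E(\ell_{i+1}-\ell_i)$; $U_i:=e^{\ell_i}(x_{i+1}-x_i)E(g_i(x_{i+1}-x_i))$ if $i=m-1$, and $U_i:=e^{\ell_{i+1}}(x_{i+1}-x_i)E(g_{i+1}(x_i-x_{i+1}))$ if $1\le i\le m-2$; $V_i:=e^{\ell_i}(x_{i+1}-x_i)E(g_i(x_{i+1}-x_i))$ if $2\le i\le m-1$, and $V_i:=e^{\ell_{i+1}}(x_{i+1}-x_i)E(g_{i+1}(x_i-x_{i+1}))$ if $i=1$. Constraints on $(\boldsymbol\ell,\boldsymbol g)$: (C1) $\ell_j\le\ell_i+g_i(x_j-x_i)$ for all $i\in\{2,\dots,m-1\}$, $j\in\{i-1,i+1\}$; and for all $B=0,\dots,B_{max}$ and all $(j,k)\in\mathcal{I}_B$: (C2) $c_B\le\sum_{i=j}^{k-1}U_i$; (C3) $c_B\le\sum_{i=j}^{k-1}V_i$; (C4) $\sum_{i=j}^{k-1}L_i\le d_B$. $\tilde{\mathcal{C}}_n(\alpha)$ is the (random) set of densities $h$ on $\mathbb{R}$ for which there exist real $g_1,\dots,g_{m-1}$ such that, with $\ell_i:=\log h(x_i)$ (real), the constraints (C1)-(C4) hold. *)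

(* Defs.v *)
From mathcomp Require Import all_boot all_order all_algebra.
From mathcomp Require Import all_classical all_reals all_analysis.

Set Implicit Arguments.
Unset Strict Implicit.
Unset Printing Implicit Defensive.

Import Order.TTheory GRing.Theory Num.Theory.
Import numFieldNormedType.Exports.

Local Open Scope classical_set_scope.
Local Open Scope ring_scope.

Definition log2 {R : realType} (x : R) : R := ln x / ln 2.

Definition is_density {R : realType} (f : R -> R) : Prop :=
  [/\ measurable_fun setT f, (forall x, 0 <= f x) &
      (\int[lebesgue_measure]_x (f x)%:E = 1)%E].

(* Since phi never takes the value +oo and 0 * -oo = 0, the left-hand side of
   the inequality is never of the form oo - oo, and t = 0, 1 are harmless. *)
Definition concave_ereal {R : realType} (phi : R -> \bar R) : Prop :=
  forall (x y t : R), 0 <= t <= 1 ->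
    ((1 - t)%:E * phi x + t%:E * phi y <= phi ((1 - t) * x + t * y)%R)%E.

Definition log_concave {R : realType} (f : R -> R) : Prop :=
  exists phi : R -> \bar R,
    [/\ (forall x, (phi x < +oo)%E), concave_ereal phi &
        forall x, (f x)%:E = expeR (phi x)].

Definition mutually_independent d (T : measurableType d) (R : realType)
    (P : probability T R) (I : finType) (X : I -> {RV P >-> R}) : Prop :=
  forall (J : {set I}) (A : I -> set R), (forall i, measurable (A i)) ->
    P (\bigcap_(i in [set` J]) (X i @^-1` A i)) =
    (\prod_(i in J) P (X i @^-1` A i))%E.

Definition has_density d (T : measurableType d) (R : realType)
    (P : probability T R) (X : {RV P >-> R}) (f : R -> R) : Prop :=
  forall A : set R, measurable A ->
    distribution P X A = (\int[lebesgue_measure]_(x in A) (f x)%:E)%E.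

(* "The event A has probability at least p", for sets A which are not known to
   be measurable: A contains a measurable event of probability at least p.
   For measurable A this is equivalent to p <= P A. *)
Definition prob_ge d (T : measurableType d) (R : realType)
    (P : probability T R) (A : set T) (p : R) : Prop :=
  exists E : set T, [/\ measurable E, E `<=` A & (p%:E <= P E)%E].

Definition quantile {R : realType} (mu : probability (measurableTypeR R) R)
    (gamma : R) : R :=
  inf [set x : R | (gamma%:E <= mu `]-oo, x]%classic)%E].

Definition qBeta {R : realType} (gamma : R) (r s : nat) : R :=
  quantile (@beta_prob R r s) gamma.

(* Families (v_1, ..., v_k) are sequences accessed with one-based indices. *)
Definition ith {R : realType} (v : seq R) (i : nat) : R := nth 0 v i.-1.

Definition order_stat {R : realType} (s : seq R) (j : nat) : R :=
  ith (sort <=%R s) j.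

Section ConfidenceSet.
Variables (R : realType) (n : nat).

(* The ceiling is nonnegative for n >= 2, so that taking its absolute value is
   a mere cast to nat. *)
Definition sn : nat := `|Num.ceil (log2 (ln (n%:R : R)))|%N.

Definition mn : nat := (n.-1 %/ 2 ^ sn).+1.

Definition Bmax : int := Num.floor (log2 ((n%:R : R) / 8)) - sn%:Z.

Definition nB (B : nat) : nat := n.-1 %/ 2 ^ (B + sn).

Definition IB (B : nat) : set (nat * nat) :=
  [set jk | exists i : nat, (1 <= i <= nB B)%N /\
    jk = ((1 + (i - 1) * 2 ^ B)%N, (1 + i * 2 ^ B)%N)].

(* Only meant for 0 <= Bmax. *)
Definition tn : R := \sum_(0 <= B < `|Bmax|.+1) (B + 2)%:R^-1.

Definition levelB (alpha : R) (B : nat) : R :=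
  alpha / (2 * (B + 2)%:R * (nB B)%:R * tn).

Definition cB (alpha : R) (B : nat) : R :=
  qBeta (levelB alpha B) (2 ^ (B + sn)) (n + 1 - 2 ^ (B + sn)).

Definition dB (alpha : R) (B : nat) : R :=
  qBeta (1 - levelB alpha B) (2 ^ (B + sn)) (n + 1 - 2 ^ (B + sn)).

Definition grid (s : n.-tuple R) : mn.-tuple R :=
  [tuple order_stat s (1 + i * 2 ^ sn) | i < mn].

Definition Efun (s : R) : R :=
  (\int[lebesgue_measure]_(t in `[0%R, 1%R]) expR (s * t))%R.

Section Constraints.
Variables (x l : mn.-tuple R) (g : (mn.-1).-tuple R).

Definition Lint (i : nat) : R :=
  (ith x i.+1 - ith x i) * expR (ith l i) * Efun (ith l i.+1 - ith l i).

(* Integrals over [x_i, x_(i+1)] of the log-affine function of slope g_i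
   (resp. g_(i+1)) through the left (resp. right) endpoint. *)
Definition tangent_left (i : nat) : R :=
  expR (ith l i) * (ith x i.+1 - ith x i)
  * Efun (ith g i * (ith x i.+1 - ith x i)).

Definition tangent_right (i : nat) : R :=
  expR (ith l i.+1) * (ith x i.+1 - ith x i)
  * Efun (ith g i.+1 * (ith x i - ith x i.+1)).

Definition Uint (i : nat) : R :=
  if i == mn.-1 then tangent_left i else tangent_right i.

Definition Vint (i : nat) : R :=
  if i == 1%N then tangent_right i else tangent_left i.

Definition C1 : Prop :=
  forall i j : nat, (2 <= i <= mn.-1)%N -> j = i.-1 \/ j = i.+1 ->
    ith l j <= ith l i + ith g i * (ith x j - ith x i).

Definition C2 (alpha : R) : Prop :=
  forall B j k : nat, B%:Z <= Bmax -> IB B (j, k) ->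
    cB alpha B <= \sum_(j <= i < k) Uint i.

Definition C3 (alpha : R) : Prop :=
  forall B j k : nat, B%:Z <= Bmax -> IB B (j, k) ->
    cB alpha B <= \sum_(j <= i < k) Vint i.

Definition C4 (alpha : R) : Prop :=
  forall B j k : nat, B%:Z <= Bmax -> IB B (j, k) ->
    \sum_(j <= i < k) Lint i <= dB alpha B.

Definition feasible (alpha : R) : Prop :=
  [/\ C1, C2 alpha, C3 alpha & C4 alpha].

End Constraints.

Definition Ctilde (alpha : R) (x : mn.-tuple R) : set (R -> R) :=
  [set h | is_density h /\
    (forall i, (1 <= i <= mn)%N -> 0 < h (ith x i)) /\
    exists g : (mn.-1).-tuple R,
      feasible x [tuple of [seq ln (h y) | y <- x]] g alpha].

Definition ell_values (alpha : R) (x : mn.-tuple R) (i : nat) : set (\bar R) :=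
  [set y | exists (l : mn.-tuple R) (g : (mn.-1).-tuple R),
     feasible x l g alpha /\ y = (ith l i)%:E].

Definition ell_hat (alpha : R) (x : mn.-tuple R) (i : nat) : \bar R :=
  ereal_inf (ell_values alpha x i).

Definition mu_hat (alpha : R) (x : mn.-tuple R) (i : nat) : \bar R :=
  ereal_sup (ell_values alpha x i).

End ConfidenceSet.

(* Main.v *)
Require Import Defs.
From mathcomp Require Import all_boot all_order all_algebra.
From mathcomp Require Import all_classical all_reals all_analysis.
From mathcomp Require Import measurable_realfun.
From mathcomp Require Import ring lra zify.

Set Implicit Arguments.
Unset Strict Implicit.
Unset Printing Implicit Defensive.

Import Order.TTheory GRing.Theory Num.Theory.
Import numFieldNormedType.Exports.

Local Open Scope classical_set_scope.
Local Open Scope ring_scope.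

(** Write [F] for the distribution function of the density [f].  On an almost
    sure event the observations are distinct and lie where [f] is positive.  The
    argument has a probabilistic half, which bounds the masses that [f] puts
    between order statistics, and a deterministic half, which turns these masses
    into the constraints.

    The variables [F (X_i)] are independent and uniform on the unit interval, so
    the mass [F (X_(j+r)) - F (X_(j))] between two order statistics is a spacing
    of a uniform sample.  Adding the origin to the sample gives [n + 1] points on
    a circle, and exchanging the roles of the origin and of the [j]th order
    statistic by a rotation is a measure preserving operation; hence the spacing
    is distributed as the [r]th order statistic of the sample, that is, as
    a Beta(r, n + 1 - r) variable, whose distribution function on the unit
    interval is the polynomial [binom_tail n r].  To avoid the joint law of
    a sample and the measurability of order statistics, the rotation is performed
    after discretization: the unit interval is cut into [N + 1] cells, the sample
    becomes a uniformly distributed function from indices to cells, and the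
    rotation is an injection on these functions ([card_spacing]).  An event that
    forces a property of the cells for every [N] is then covered by a measurable
    set whose probability is at most the limit of the counting ratios
    ([cells_cover]); this gives both tails of the spacings ([spacing_lower],
    [spacing_upper]) and the absence of ties ([ties_cover]).  Since quantiles of
    the beta distribution are exact ([qBetaP]), each block of the scheme violates
    its bounds [cB] and [dB] with probability at most [2 * levelB], and the levels
    are chosen so that the sum over all blocks is at most [alpha]
    ([level_sum], [good_event]).

    On the event so obtained, [ln f] is concave between the grid points, so the
    integral of [f] over a grid interval is at least the integral of the
    exponential of the chord and at most the integral of the exponential of
    a tangent taken at either end which is an interior grid point
    ([log_concave_grid]).  Summing over a block, the sum of the [Lint] is at most
    the mass of the block, itself at most the sums of the [Uint] and of the
    [Vint]; with the bounds on the mass of the block, [f] satisfies all the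
    constraints ([good_Ctilde]).  The second claim follows because the values of
    [ln f] are then feasible.  For the third one, any feasible vector of
    log-values is attained by a density, since a density may be changed at
    finitely many points; this only requires the grid points to be distinct
    ([ell_values_Ctilde]). *)

(** * The beta distribution function as a binomial tail *)

Definition binom_tail (R : realType) (n r : nat) : {poly R} :=
  \sum_(r <= a < n.+1) 'C(n, a)%:R *: ('X^a * (1 - 'X) ^+ (n - a)).

(** The derivative of the term of index [a + 1] is the difference of the terms of
    indices [a] and [a + 1] of degree [m], so that the sum telescopes. *)
Lemma deriv_binom_tail (R : realType) (m r : nat) : (r <= m)%N ->
  (binom_tail R m.+1 r.+1)^`() =
    (m.+1 * 'C(m, r))%:R *: ('X^r * (1 - 'X) ^+ (m - r)).
Proof.
move=> rm; pose T a : {poly R} :=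
  (m.+1 * 'C(m, a))%:R *: ('X^a * (1 - 'X) ^+ (m - a)).
have dT a : (r <= a < m.+1)%N ->
    ('C(m.+1, a.+1)%:R *: ('X^(a.+1) * (1 - 'X) ^+ (m.+1 - a.+1)))^`() =
    - T a.+1 - - T a :> {poly R}.
  move=> /andP[_ am]; rewrite opprK derivZ derivM derivXn deriv_exp.
  rewrite derivB derivX derivC sub0r subSS /=.
  rewrite mulN1r mulNrn mulrN scalerBr mulrnAl -[RHS]addrC; congr (_ - _).
    by rewrite /T -scalerMnr scalerMnl -mulrnA [('C(_, _) * _)%N]mulnC -mul_bin_diag.
  rewrite /T -subnS; case: (ltnP a m) => [lam|mla]; last first.
    have -> : a = m by apply/eqP; rewrite eqn_leq mla -ltnS am.
    by rewrite subnn mulr0n mulr0 scaler0 bin_small// muln0 scale0r.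
  rewrite mulrnAr -scalerMnr scalerMnl -mulrnA; congr (_%:R *: _).
  by rewrite mulnC [RHS](mul_bin_down m.+1) subSS.
rewrite /binom_tail big_add1/= (raddf_sum (@deriv R)) /= (eq_big_nat _ _ dT).
rewrite (telescope_sumr (fun a => - T a)) ?leqW// opprK addrC.
by rewrite {2}/T bin_small// muln0 scale0r subr0.
Qed.

Lemma binom_tail0 (R : realType) (n r : nat) : (0 < r)%N ->
  (binom_tail R n r).[0] = 0.
Proof.
move=> r0; rewrite horner_sum big_nat big1// => a /andP[ra _].
by rewrite hornerZ hornerM hornerXn expr0n gtn_eqF ?(leq_trans r0)// mul0r mulr0.
Qed.

Lemma binom_tail1 (R : realType) (n r : nat) : (r <= n)%N ->
  (binom_tail R n r).[1] = 1.
Proof.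
move=> rn; rewrite horner_sum big_nat_recr//= big_nat big1 ?add0r.
  by rewrite hornerZ hornerM hornerXn subnn binn expr1n expr0 hornerC !mul1r.
move=> a /andP[_ an]; rewrite hornerZ hornerM !horner_exp hornerD hornerN hornerC hornerX.
by rewrite subrr expr0n subn_eq0 leqNgt an !mulr0.
Qed.

(** Both sides vanish at the origin, and [deriv_binom_tail] identifies the
    derivative of the right-hand side with the beta density. *)
Lemma beta_prob_binom_tail (R : realType) (n r : nat) (x : R) :
  (0 < r <= n)%N -> 0 <= x <= 1 ->
  beta_prob r (n + 1 - r) `]-oo, x] = ((binom_tail R n r).[x])%:E.
Proof.
case: r => // r; case: n => // m /andP[_ /[!ltnS] rm] /andP[x0 x1].
have -> : (m.+1 + 1 - r.+1 = (m - r).+1)%N by rewrite addn1 subSS subSn.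
rewrite /beta_prob /mscale /= integral_XMonemX_restrict.
have -> : `]-oo, x] `&` `[0%R, 1%R] = `[0%R, x]%classic :> set R.
  apply/seteqP; split => y /=; rewrite !in_itv/=.
    by move=> [-> /andP[->]].
  by move=> /andP[y0 yx]; rewrite y0 yx (le_trans yx).
move: x0; rewrite le_eqVlt => /predU1P[<-|x0].
  by rewrite set_itv1 integral_set1 mule0 binom_tail0.
set c : R := (m.+1 * 'C(m, r))%:R.
have cE : (beta_fun r.+1 (m - r).+1)^-1 = c.
  rewrite beta_fun_fact subnKC// invf_div /c factS -(bin_fact rm) mulnA.
  by rewrite [in LHS]natrM mulfK// pnatr_eq0 -lt0n muln_gt0 !fact_gt0.
rewrite (@continuous_FTC2 _ (XMonemX r (m - r))
  (horner (c^-1 *: binom_tail R m.+1 r.+1))) //.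
- rewrite !hornerE binom_tail0// mulr0 sube0 -EFinM cE.
  rewrite mulVKf// /c pnatr_eq0 muln_eq0 negb_or /= -lt0n bin_gt0 //.
- exact: within_continuous_XMonemX.
- split; first by move=> *; exact: derivable_horner.
    by apply: cvg_at_right_filter; exact: continuous_horner.
  by apply: cvg_at_left_filter; exact: continuous_horner.
- move=> y _; rewrite -derivE derivZ deriv_binom_tail// scalerA mulVf ?scale1r.
    by rewrite !hornerE.
  by rewrite /c pnatr_eq0 muln_eq0 negb_or /= -lt0n bin_gt0.
Qed.

(** The distribution function is continuous and takes every value of the unit
    interval on it; the infimum defining the quantile is therefore a point where
    the value [g] is taken, and both tails at a quantile have exact masses. *)
Lemma qBetaP (R : realType) (n r : nat) (g : R) :
  (0 < r <= n)%N -> 0 < g < 1 ->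
  0 <= qBeta g r (n + 1 - r) <= 1 /\
  (binom_tail R n r).[qBeta g r (n + 1 - r)] = g.
Proof.
move=> rn /andP[g0 g1]; have /andP[r0 rn'] := rn.
set mu := @beta_prob R r (n + 1 - r).
set S := [set x : R | (g%:E <= mu `]-oo, x]%classic)%E].
have qE : qBeta g r (n + 1 - r) = inf S by [].
have H0 (x : R) : 0 <= x <= 1 -> mu `]-oo, x]%classic = ((binom_tail R n r).[x])%:E.
  exact: beta_prob_binom_tail.
have Hmono (x y : R) : x <= y -> (mu `]-oo, x]%classic <= mu `]-oo, y]%classic)%E.
  by move=> xy; rewrite le_measure ?inE//; exact: subitvPr.
have ivt a : 0 <= a <= 1 -> exists2 z, 0 <= z <= 1 & (binom_tail R n r).[z] = a.
  move=> a01; have [||z] := @IVT R (horner (binom_tail R n r)) 0 1 a ler01.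
  - exact/continuous_subspaceT/continuous_horner.
  - by rewrite binom_tail0// binom_tail1// minEle maxEle ler01.
  - by rewrite in_itv/= => z01 ?; exists z.
have [z z01 zg] := ivt g (introT andP (conj (ltW g0) (ltW g1))).
have Sz : S z by rewrite /S/= H0// zg.
have S0 y : S y -> 0 <= y.
  move=> Sy; rewrite leNgt; apply/negP => y0.
  suff : (g%:E <= 0)%E by rewrite lee_fin leNgt g0.
  by rewrite (le_trans Sy)// (le_trans (Hmono _ 0 (ltW y0)))// H0 ?lexx ?ler01// binom_tail0.
have lS : has_lbound S by exists 0 => y /S0.
have q0 : 0 <= inf S by apply: lb_le_inf; [exists z | move=> y /S0].
have qz : inf S <= z by exact: ge_inf.
have q01 : 0 <= inf S <= 1.
  by rewrite q0 (le_trans qz)//; case/andP: z01.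
rewrite qE; split => //; apply/eqP; rewrite eq_le; apply/andP; split.
  by rewrite -lee_fin -H0// -zg -H0// Hmono.
rewrite leNgt; apply/negP => qg.
(* Otherwise some value strictly between the two is attained, at a point [w]
   which is a larger lower bound of [S]. *)
set b := ((binom_tail R n r).[inf S] + g) / 2.
have [qb bg] := midf_lt qg.
have [|w w01 wb] := ivt b.
  rewrite (ltW (le_lt_trans _ qb)) ?(ltW (lt_trans bg g1))//.
  by rewrite -lee_fin -H0.
have qw : inf S < w.
  rewrite ltNge; apply/negP => /Hmono.
  by rewrite !H0// lee_fin wb leNgt qb.
move: qw; rewrite ltNge => /negP; apply; apply: lb_le_inf; first by exists z.
move=> y Sy; rewrite leNgt; apply/negP => /ltW/Hmono.
by move=> /(le_trans Sy); rewrite H0// lee_fin wb leNgt bg.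
Qed.

(** * Spacings of points on a discrete circle *)

Section DiscreteCircle.
Local Close Scope classical_set_scope.
Local Open Scope nat_scope.

(** The origin [0] counts as an additional point of the circle of integers modulo
    [N + 1], hence it must not be occupied by a point of [v]. *)
Definition distinct_nz (n N : nat) (v : {ffun 'I_n -> 'I_N.+1}) : bool :=
  injectiveb v && [forall l, v l != 0%R].

Definition rank (n N : nat) (v : {ffun 'I_n -> 'I_N.+1}) (i : 'I_n) : nat :=
  #|[set l | v l < v i]|.

(** For [v] injective and [j + r < n]: the values of ranks [j] and [j + r] differ
    by at least [q]. *)
Definition spacing_ge (n N j q r : nat) (v : {ffun 'I_n -> 'I_N.+1}) : bool :=
  [exists i, (rank v i == j) && (#|[set l | v i < v l < v i + q]| < r)].

(** The [r]th smallest value, counted from one, is at least [q]. *)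
Definition few_below (n N q r : nat) (v : {ffun 'I_n -> 'I_N.+1}) : bool :=
  #|[set l | v l < q]| < r.

(** The rotation of the circle which brings the point of index [i] to the origin;
    the former origin receives the index [i]. *)
Definition rotate (n N : nat) (i : 'I_n) (v : {ffun 'I_n -> 'I_N.+1}) :
    {ffun 'I_n -> 'I_N.+1} :=
  [ffun l => ((if l == i then 0 else v l) - v i)%R].

Lemma rotateK (n N : nat) (i : 'I_n) : involutive (@rotate n N i).
Proof.
move=> v; apply/ffunP => l; rewrite !ffunE eqxx sub0r opprK.
by case: eqVneq => [->|_]; rewrite ?add0r ?subrK.
Qed.

Lemma distinct_nz_rotate (n N : nat) (i : 'I_n) (v : {ffun 'I_n -> 'I_N.+1}) :
  distinct_nz v -> distinct_nz (rotate i v).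
Proof.
move=> /andP[/injectiveP vI /forallP v0]; apply/andP; split.
  apply/injectiveP => l l'; rewrite !ffunE => /addIr.
  case: eqVneq => [->|li]; case: eqVneq => [->|l'i] //; last exact: vI.
    by move/eqP; rewrite eq_sym (negbTE (v0 l')).
  by move/eqP; rewrite (negbTE (v0 l)).
apply/forallP => l; rewrite ffunE; case: (eqVneq l i) => [_|li].
  by rewrite sub0r oppr_eq0 v0.
by rewrite subr_eq0 (inj_eq vI).
Qed.

Lemma val_rotate (n N : nat) (i l : 'I_n) (v : {ffun 'I_n -> 'I_N.+1}) :
  distinct_nz v -> rotate i v l =
    (if l == i then N.+1 - v i else
     if v i < v l then v l - v i else v l + N.+1 - v i) :> nat.
Proof.
move=> /andP[/injectiveP vI /forallP v0]; rewrite ffunE.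
have vi0 : 0 < v i by rewrite lt0n; exact: v0.
have viN := ltn_ord (v i); have vlN := ltn_ord (v l).
case: eqVneq => [_|li].
  by rewrite sub0r /= modn_small// ltn_subrL vi0.
rewrite /= modnDmr addnBA ?(ltnW viN)//.
case: ltnP => [lt|le].
  by rewrite addnC -addnBA ?(ltnW lt)// modnDl modn_small// (leq_ltn_trans (leq_subr _ _)).
rewrite modn_small// ltn_subLR ?ltn_add2r ?(leq_trans (ltnW viN)) ?leq_addl//.
rewrite ltn_neqAle le andbT; apply: contra_neq li => /val_inj; exact: vI.
Qed.

Lemma rank_inj (n N : nat) (v : {ffun 'I_n -> 'I_N.+1}) :
  injectiveb v -> injective (rank v).
Proof.
move=> /injectiveP vI.
have lt_rank i i' : v i < v i' -> rank v i < rank v i'.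
  move=> lt; apply/proper_card/properP; split.
    by apply/fintype.subsetP => l; rewrite !inE => /ltn_trans; exact.
  by exists i; rewrite !inE ?ltnn.
move=> i i' eqr; apply: vI; apply/val_inj/eqP => /=.
by case: ltngtP => // /lt_rank; rewrite eqr ltnn.
Qed.

Lemma rank_surj (n N : nat) (v : {ffun 'I_n -> 'I_N.+1}) (j : nat) :
  injectiveb v -> j < n -> exists i, rank v i = j.
Proof.
move=> vI jn.
have ltr i : rank v i < n.
  rewrite -[X in _ < X](card_ord n) -cardsT; apply/proper_card/properP.
  by split; [exact: finset.subsetT | exists i; rewrite !inE ?ltnn].
have rI : injective (fun i => Ordinal (ltr i)).
  by move=> i i' [] /(rank_inj vI).
exists (invF rI (Ordinal jn)).
exact: (congr1 val (f_invF rI (Ordinal jn))).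
Qed.

(** Seen from the point [i], the former origin is preceded exactly by the points
    that were above [i]. *)
Lemma rank_rotate (n N : nat) (i : 'I_n) (v : {ffun 'I_n -> 'I_N.+1}) :
  distinct_nz v -> rank (rotate i v) i = n - (rank v i).+1.
Proof.
move=> pv; have /andP[/injectiveP vI _] := pv.
rewrite /rank.
have -> : [set l | rotate i v l < rotate i v i] =
          ~: (i |: [set l | v l < v i]).
  apply/setP => l; rewrite !inE !val_rotate// eqxx.
  have viN := ltn_ord (v i); have vlN := ltn_ord (v l).
  case: eqVneq => [->|li] /=; first by rewrite ltnn.
  have : v i != v l by apply: contra_neq li => /vI.
  rewrite -val_eqE neq_ltn => /orP[] lt.
    by rewrite lt (ltn_sub2r viN vlN) -leqNgt ltnW.
  have -> : (v i < v l) = false by rewrite ltnNge ltnW.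
  rewrite lt /=; apply/negbTE; rewrite -leqNgt leq_sub2r//.
  by rewrite leq_addl.
by rewrite cardsCs finset.setCK cardsU1 !inE ltnn card_ord.
Qed.

(** The points at distance less than [q] after [i] become those below [q], as long
    as the arc does not pass the former origin.  If it does, then it contains
    all the [n - j - 1 >= r] points above [i], and both conditions fail. *)
Lemma spacing_rotate (n N j q r : nat) (i : 'I_n) (v : {ffun 'I_n -> 'I_N.+1}) :
  distinct_nz v -> rank v i = j -> j + r < n ->
  (#|[set l | v i < v l < v i + q]| < r) = few_below q r (rotate i v).
Proof.
move=> pv rk jrn; have /andP[/injectiveP vI _] := pv.
have viN := ltn_ord (v i).
have -> : [set l | v i < v l < v i + q] =
    [set l | (rotate i v l < rotate i v i) && (rotate i v l < q)].
  apply/setP => l; rewrite !inE !val_rotate// eqxx.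
  have vlN := ltn_ord (v l).
  case: eqVneq => [->|li] /=; first by rewrite !ltnn.
  case: (ltnP (v i) (v l)) => [lt|le] /=.
    by rewrite (ltn_sub2r viN vlN) /= ltn_subLR// ltnW.
  by rewrite ltnNge leq_sub2r ?leq_addl.
rewrite /few_below; have [qi|iq] := leqP q (rotate i v i).
  congr (#|pred_of_set _| < r); apply/setP => l; rewrite !inE.
  by apply: andb_idl => /leq_trans; exact.
have rr : r <= rank (rotate i v) i.
  by rewrite rank_rotate// rk leq_subRL ?addnS ?addSn// (leq_ltn_trans _ jrn) ?leq_addr.
have -> : [set l | (rotate i v l < rotate i v i) && (rotate i v l < q)] =
    [set l | rotate i v l < rotate i v i].
  by apply/setP => l; rewrite !inE; apply: andb_idr => /ltn_trans; exact.
rewrite ltnNge rr /=; apply/esym/negbTE; rewrite -leqNgt (leq_trans rr)//.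
apply: subset_leq_card; apply/fintype.subsetP => l; rewrite !inE => /ltn_trans; exact.
Qed.

(** Rotating around the point of rank [j] is injective, because that point can be
    recognized after the rotation as the one of rank [n - j - 1], and because
    [rotate i] is an involution.  This is the discrete form of the fact that all
    spacings of order [r] have the law of the [r]th order statistic. *)
Lemma card_spacing (n N j q r : nat) (b : bool) : j + r < n ->
  #|[set v : {ffun 'I_n -> 'I_N.+1} | distinct_nz v && (spacing_ge j q r v == b)]| <=
  #|[set v : {ffun 'I_n -> 'I_N.+1} | few_below q r v == b]|.
Proof.
move=> jrn; have jn : j < n by rewrite (leq_ltn_trans _ jrn) ?leq_addr.
(* The index of rank [j] is unique, so [pick] has no freedom. *)
pose Phi (v : {ffun 'I_n -> 'I_N.+1}) :=
  if [pick i | rank v i == j] is Some i then rotate i v else v.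
have PhiE v : distinct_nz v -> exists2 i, rank v i = j & Phi v = rotate i v.
  move=> /andP[vI _]; rewrite /Phi; case: pickP => [i /eqP ri|]; first by exists i.
  by have [i /eqP ri] := rank_surj vI jn => /(_ i); rewrite ri.
rewrite -(card_in_imset (f := Phi)); last first.
  move=> v v'; rewrite !inE => /andP[pv _] /andP[pv' _].
  have [i ri ->] := PhiE v pv; have [i' ri' ->] := PhiE v' pv'.
  move=> eqv; have : rank (rotate i v) i = rank (rotate i v) i'.
    by rewrite [in RHS]eqv !rank_rotate// ri ri'.
  move/rank_inj => eqi; have ii' : i = i'.
    by apply: eqi; case/andP: (distinct_nz_rotate i pv).
  by move: eqv; rewrite ii' => /(can_inj (@rotateK _ _ i')).
apply/subset_leq_card/fintype.subsetP => _ /imsetP[v + ->].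
rewrite !inE => /andP[pv]; have [i ri ->] := PhiE v pv.
suff -> : spacing_ge j q r v = few_below q r (rotate i v) by [].
rewrite -(spacing_rotate q pv ri jrn); apply/existsP/idP => [[i']|].
  have /andP[vI _] := pv.
  by move=> /andP[/eqP ri']; have -> : i' = i by apply: (rank_inj vI); rewrite ri'.
by move=> lt; exists i; rewrite ri eqxx.
Qed.

Lemma card_distinct_nz (n N : nat) :
  (N.+1 - n) ^ n <= #|[set v : {ffun 'I_n -> 'I_N.+1} | distinct_nz v]|.
Proof.
have -> : #|[set v : {ffun 'I_n -> 'I_N.+1} | distinct_nz v]| = N ^_ n.
  have cN : #|[pred x : 'I_N.+1 | x != 0%R]| = N.
    by rewrite -[RHS]/(N.+1.-1) -[in RHS](card_ord N.+1) -(cardC1 (0%R : 'I_N.+1)).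
  have -> : [set v : {ffun 'I_n -> 'I_N.+1} | distinct_nz v] =
      [set v in ffun_on [pred x : 'I_N.+1 | x != 0%R] | injectiveb v].
    apply/setP => v; rewrite !finset.in_set andbC; congr (_ && _).
  by rewrite card_inj_ffuns_on cN card_ord.
rewrite ffact_prod -[X in _ ^ X]card_ord -prod_nat_const.
by apply: leq_prod => i _; have := ltn_ord i; lia.
Qed.

(** The functions are sorted by the set of the indices of the values below [q]. *)
Lemma card_few_below (n N q r : nat) : q <= N.+1 ->
  #|[set v : {ffun 'I_n -> 'I_N.+1} | ~~ few_below q r v]| =
  \sum_(r <= a < n.+1) 'C(n, a) * (q ^ a * (N.+1 - q) ^ (n - a)).
Proof.
move=> qN; pose J (v : {ffun 'I_n -> 'I_N.+1}) := [set l | v l < q].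
have cardJ (A : {set 'I_n}) :
    \sum_(v | J v == A) 1 = q ^ #|A| * (N.+1 - q) ^ (n - #|A|).
  pose F l := if l \in A then [pred x : 'I_N.+1 | x < q]
              else [pred x : 'I_N.+1 | q <= x].
  have cq : #|[pred x : 'I_N.+1 | x < q]| = q.
    rewrite -sum1_card -[RHS]card_ord -sum1_card.
    by rewrite (big_ord_widen _ (fun=> 1) qN).
  rewrite (eq_bigl (mem (family F))); last first.
    move=> v; apply/eqP/familyP => [JA l|h].
      by rewrite /F -JA inE; case: ltnP; rewrite inE.
    apply/setP => l; rewrite inE; have := h l; rewrite /F.
    by case: (l \in A); rewrite inE => // /leq_gtF.
  rewrite sum1_card card_family foldrE big_image /= (bigID (mem A)) /=.
  rewrite (eq_bigr (fun=> q)); last by move=> l lA; rewrite /F lA cq.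
  rewrite prod_nat_const (eq_bigr (fun=> N.+1 - q)); last first.
    move=> l /negbTE lA; rewrite /F lA -[in RHS]cq -[X in X - _](card_ord N.+1).
    rewrite -(cardC [pred x : 'I_N.+1 | x < q]) addKn.
    by apply: eq_card => x; rewrite !inE -leqNgt.
  rewrite prod_nat_const; congr (_ * _ ^ _).
  by rewrite -[X in X - _](card_ord n) -(cardC (mem A)) addKn.
rewrite -sum1_card (partition_big J (fun A => r <= #|A|)) /=; last first.
  by move=> v; rewrite inE -leqNgt.
under eq_bigr => A rA.
  rewrite (eq_bigl (fun v => J v == A)); last first.
    move=> v; rewrite inE -leqNgt; apply: andb_idl => /eqP JA.
    by rewrite -/(J v) JA.
  rewrite cardJ; over.
have AN (A : {set 'I_n}) : #|A| < n.+1 by rewrite ltnS -[n in _ <= n]card_ord max_card.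
rewrite (partition_big (fun A : {set 'I_n} => Ordinal (AN A)) (fun a => r <= a)) //=.
rewrite big_geq_mkord; apply: eq_bigr => a ra.
rewrite (eq_bigr (fun=> q ^ a * (N.+1 - q) ^ (n - a))); last first.
  by move=> A /andP[_ /eqP <-].
rewrite sum_nat_const -[X in 'C(X, _)](card_ord n) -card_draws; congr (_ * _).
apply: eq_card => A; rewrite !inE; apply/andP/eqP => [[_ /eqP <-] //|Aa].
by split; [rewrite Aa|apply/eqP/val_inj].
Qed.

End DiscreteCircle.

(** * Probability integral transform and discretization *)

Definition density_cdf (R : realType) (f : R -> R) (x : R) : R :=
  \int[lebesgue_measure]_(y in `]-oo, x]) f y.

Lemma density_integrable (R : realType) (f : R -> R) (A : set R) :
  is_density f -> measurable A -> lebesgue_measure.-integrable A (EFin \o f).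
Proof.
move=> [mf f0 f1] mA; apply: (@integrableS _ _ _ _ setT) => //.
apply/integrableP; split; first exact/measurable_EFinP.
under eq_integral do rewrite /= ger0_norm ?f0//.
by rewrite f1 ltry.
Qed.

Lemma density_cdf_diff (R : realType) (f : R -> R) (a b : R) : is_density f -> a <= b ->
  density_cdf f b - density_cdf f a = \int[lebesgue_measure]_(y in `[a, b]) f y.
Proof.
move=> df ab; rewrite /density_cdf Rintegral_itvB ?bnd_simp//; last exact: density_integrable.
rewrite Rintegral_itv_obnd_cbnd//.
by apply: density_integrable.
Qed.

Lemma density_cdf_le (R : realType) (f : R -> R) : is_density f ->
  {homo density_cdf f : x y / x <= y}.
Proof.
move=> df a b ab; rewrite -subr_ge0 density_cdf_diff//.
by apply: Rintegral_ge0 => x _; case: df.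
Qed.

Lemma distribution_itvNy d (T : measurableType d) (R : realType)
    (P : probability T R) (X : {RV P >-> R}) (f : R -> R) (x : R) :
  is_density f -> has_density X f ->
  distribution P X `]-oo, x] = (density_cdf f x)%:E.
Proof.
move=> df hX; rewrite hX// /density_cdf /Rintegral fineK//.
by apply: integrable_fin_num => //; exact: density_integrable.
Qed.

Lemma prim01 d (T : measurableType d) (R : realType)
    (P : probability T R) (X : {RV P >-> R}) (f : R -> R) (x : R) :
  is_density f -> has_density X f -> 0 <= density_cdf f x <= 1.
Proof.
move=> df hX; rewrite -!lee_fin -(distribution_itvNy x df hX).
by rewrite measure_ge0 probability_le1.
Qed.

Lemma density_cdf_surj d (T : measurableType d) (R : realType)
    (P : probability T R) (X : {RV P >-> R}) (f : R -> R) (t : R) :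
  is_density f -> has_density X f -> 0 < t < 1 -> exists y, density_cdf f y = t.
Proof.
move=> df hX /andP[t0 t1].
have pE : fine \o cdf X = density_cdf f.
  by apply/funext => x; rewrite /= /cdf (distribution_itvNy x df hX).
have [a at_] : exists a, density_cdf f a < t.
  have cN : density_cdf f x @[x --> -oo] --> (0 : R).
    by rewrite -pE; apply: (@fine_cvg _ _ _ _ _ 0%R); exact: cvg_cdfNy0.
  exact: filter_ex (cvgr_lt _ cN _ t0).
have [b tb] : exists b, t < density_cdf f b.
  have cy : density_cdf f x @[x --> +oo] --> (1 : R).
    by rewrite -pE; apply: (@fine_cvg _ _ _ _ _ 1%R); exact: cvg_cdfy1.
  exact: filter_ex (cvgr_gt _ cy _ t1).
have ab : a <= b.
  rewrite leNgt; apply/negP => /ltW /(density_cdf_le df).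
  by rewrite leNgt (lt_trans at_ tb).
(* On a segment, the primitive is continuous up to an additive constant. *)
pose G x := parameterized_integral lebesgue_measure a x f.
have GE x : a <= x -> G x = density_cdf f x - density_cdf f a.
  by move=> ax; rewrite density_cdf_diff.
have [||y] := @IVT R G a b (t - density_cdf f a) ab.
- apply: parameterized_integral_continuous => //.
  by apply: density_integrable.
- by rewrite !GE// subrr minEle maxEle subr_ge0 (density_cdf_le df ab) subr_ge0 lerD2r !ltW.
- rewrite in_itv/= => /andP[ay _]; rewrite GE// => /addIr <-.
  by exists y.
Qed.

(** The probability integral transform.  As [density_cdf f] takes every value [s]
    strictly between 0 and 1, the event lies between half-lines of mass [t] and of
    mass [s], for every [s < t]. *)
Lemma density_cdf_uniform d (T : measurableType d) (R : realType)
    (P : probability T R) (X : {RV P >-> R}) (f : R -> R) (t : R) :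
  is_density f -> has_density X f -> 0 <= t < 1 ->
  distribution P X [set x | density_cdf f x < t] = t%:E.
Proof.
move=> df hX /andP[]; rewrite le_eqVlt => /predU1P[<- _|t0 t1].
  rewrite (_ : [set _ | _] = set0) ?measure0//; apply/seteqP; split=> // x /=.
  by case/andP: (prim01 x df hX) => /le_gtF ->.
have mt : measurable [set x | density_cdf f x < t].
  rewrite (_ : [set _ | _] = setT `&` density_cdf f @^-1` `]-oo, t[).
    by apply: (nondecreasing_measurable measurableT (density_cdf_le df)).
  by rewrite setTI; apply/seteqP; split => x /=; rewrite in_itv.
apply/eqP; rewrite eq_le; apply/andP; split.
  have [|y yt] := @density_cdf_surj _ _ _ _ _ _ t df hX; first by rewrite t0.
  rewrite -[X in (_ <= X%:E)%E]yt -(distribution_itvNy y df hX).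
  apply: le_measure; rewrite ?inE// => x /=; rewrite in_itv/= -yt => lt.
  by rewrite leNgt; apply/negP => /ltW /(density_cdf_le df); rewrite leNgt lt.
have D1 : distribution P X [set x | density_cdf f x < t] \is a fin_num.
  exact: fin_num_measure.
rewrite -(fineK D1) lee_fin leNgt; apply/negP => lt.
set c := fine _ in lt.
have c0 : 0 <= c by rewrite fine_ge0.
have [cm mt'] := midf_lt lt; set m := (c + t) / 2 in cm mt'.
have [|y ym] := @density_cdf_surj _ _ _ _ _ _ m df hX.
  by rewrite (le_lt_trans c0 cm) (lt_trans mt').
suff : (m%:E <= c%:E)%E by rewrite lee_fin leNgt cm.
rewrite /c fineK// -ym -(distribution_itvNy y df hX).
apply: le_measure; rewrite ?inE// => x /=; rewrite in_itv/= => /(density_cdf_le df).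
by rewrite ym => /le_lt_trans; exact.
Qed.

(** The minimum puts the value [u = 1] in the last cell. *)
Definition cell (R : realType) (N : nat) (u : R) : 'I_N.+1 :=
  inord (minn (Num.truncn (N.+1%:R * u)) N).

Lemma val_cell (R : realType) (N : nat) (u : R) :
  cell N u = minn (Num.truncn (N.+1%:R * u)) N :> nat.
Proof. by rewrite inordK// ltnS geq_minr. Qed.

Lemma cell_ge (R : realType) (N k : nat) (u : R) : (k <= N)%N -> 0 <= u ->
  (k <= cell N u)%N = (k%:R / N.+1%:R <= u).
Proof.
move=> kN u0; rewrite val_cell leq_min kN andbT truncn_ge_nat ?mulr_ge0//.
by rewrite ler_pdivrMr ?ltr0n// mulrC.
Qed.

Lemma cell_bounds (R : realType) (N : nat) (u : R) : 0 <= u <= 1 ->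
  (cell N u)%:R <= N.+1%:R * u <= (cell N u).+1%:R.
Proof.
move=> /andP[u0 u1]; rewrite val_cell.
have /andP[lo up] := truncn_itv (mulr_ge0 (ler0n _ N.+1) u0).
apply/andP; split.
  by rewrite (le_trans _ lo)// ler_nat geq_minl.
case: leqP => _; first exact: ltW.
by rewrite ler_piMr.
Qed.

Lemma cell_le (R : realType) (N : nat) (u v : R) : u <= v ->
  (cell N u <= cell N v)%N.
Proof.
move=> uv; rewrite !val_cell leq_min geq_minr andbT.
by rewrite (leq_trans (geq_minl _ _))// le_truncn// ler_wpM2l.
Qed.

Lemma prob_cell d (T : measurableType d) (R : realType)
    (P : probability T R) (X : {RV P >-> R}) (f : R -> R) (N : nat) (v : 'I_N.+1) :
  is_density f -> has_density X f ->
  let A := [set x | cell N (density_cdf f x) = v] in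
  measurable A /\ P (X @^-1` A) = (N.+1%:R^-1)%:E.
Proof.
move=> df hX A.
have u0 x : 0 <= density_cdf f x by case/andP: (prim01 x df hX).
pose B (k : nat) := [set x | (cell N (density_cdf f x) < k)%N].
have BE k : (k <= N)%N -> B k = [set x | density_cdf f x < k%:R / N.+1%:R].
  move=> kN; by apply/seteqP; split=> x; rewrite /B /= ltnNge cell_ge// -ltNge.
have PB k : (k <= N.+1)%N -> measurable (B k) /\
    distribution P X (B k) = (k%:R / N.+1%:R)%:E.
  rewrite leq_eqVlt => /predU1P[->|].
    rewrite (_ : B _ = setT); last first.
      by apply/seteqP; split=> // x _; exact: ltn_ord.
    by rewrite probability_setT divff// pnatr_eq0.
  rewrite ltnS => kN; rewrite BE//; split; last first.
    apply: density_cdf_uniform => //.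
    by rewrite divr_ge0//= ltr_pdivrMr ?ltr0n// mul1r ltr_nat ltnS.
  rewrite (_ : [set _ | _] = setT `&` density_cdf f @^-1` `]-oo, k%:R / N.+1%:R[).
    by apply: (nondecreasing_measurable measurableT (density_cdf_le df)).
  by rewrite setTI; apply/seteqP; split => x /=; rewrite in_itv.
have AE : A = B v.+1 `\` B v.
  apply/seteqP; split=> x; rewrite /A /B /=; first by move=> ->; rewrite ltnSn ltnn.
  move=> [+ /negP]; rewrite ltnS -leqNgt => h1 h2.
  by apply/val_inj/eqP; rewrite eqn_leq h1 h2.
have [mB PBv] := PB v (ltnW (ltn_ord v)).
have [mB' PBv'] := PB v.+1 (ltn_ord v).
have mA : measurable A by rewrite AE; exact: measurableD.
split=> //; rewrite -[LHS]/(distribution P X A) AE measureD//; last first.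
  by rewrite (le_lt_trans (probability_le1 _ _))// ltry.
rewrite setIidr; last by move=> x /=; exact: ltnW.
transitivity ((v.+1%:R / N.+1%:R)%:E - (v%:R / N.+1%:R)%:E : \bar R)%E;
  first by rewrite -PBv -PBv'.
by rewrite -EFinB -mulrBl -natrB// subSnn mul1r.
Qed.

Lemma measure_bigsetU_le d (T : measurableType d) (R : realType)
    (P : probability T R) (I : Type) (s : seq I) (Q : pred I) (A : I -> set T) :
  (forall i, measurable (A i)) ->
  (P (\big[setU/set0]_(i <- s | Q i) A i) <= \sum_(i <- s | Q i) P (A i))%E.
Proof.
move=> mA; elim: s => [|i s ih]; first by rewrite !big_nil measure0.
rewrite !big_cons; case: ifP => // _.
apply: le_trans (leeD2l _ ih); apply: measureU2 => //.
exact: bigsetU_measurable.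
Qed.

(** By independence, all the patterns of cells are equally likely. *)
Lemma prob_cells_le d (T : measurableType d) (R : realType)
    (P : probability T R) (n N : nat) (X : 'I_n -> {RV P >-> R}) (f : R -> R)
    (S : {set {ffun 'I_n -> 'I_N.+1}}) :
  is_density f -> mutually_independent X -> (forall i, has_density (X i) f) ->
  let E := [set w | [ffun i => cell N (density_cdf f (X i w))] \in S] in
  measurable E /\ (P E <= (#|S|%:R / N.+1%:R ^+ n)%:E)%E.
Proof.
move=> df hI hX E.
pose A (v : 'I_N.+1) := [set x | cell N (density_cdf f x) = v].
pose C (v : {ffun 'I_n -> 'I_N.+1}) :=
  \bigcap_(i in [set` [set: 'I_n]%SET]) (X i @^-1` A (v i)).
have PC v : measurable (C v) /\ P (C v) = (N.+1%:R^-1 ^+ n)%:E.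
  have mA i : measurable (A (v i)) by case: (prob_cell (v i) df (hX i)).
  split.
    apply: fin_bigcap_measurable => // i _.
    by rewrite -[X in measurable X]setTI; exact: measurable_funP.
  rewrite /C (hI _ (fun i => A (v i)))//.
  rewrite (eq_bigr (fun=> (N.+1%:R^-1)%:E)); last first.
    by move=> i _; case: (prob_cell (v i) df (hX i)).
  by rewrite prodEFin prodr_const cardsT card_ord.
have EE : E = \big[setU/set0]_(v in S) C v.
  rewrite -bigcup_seq_cond; apply/seteqP; split=> [w Ew|w [v /andP[_ vS] Cw]].
    exists [ffun i => cell N (density_cdf f (X i w))].
      by rewrite /= mem_index_enum.
    by move=> i _; rewrite /A /= ffunE.
  rewrite /E /=; suff -> : [ffun i => cell N (density_cdf f (X i w))] = v by [].
  by apply/ffunP => i; rewrite ffunE; apply: Cw; rewrite /= inE.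
have mC v : measurable (C v) by case: (PC v).
split; first by rewrite EE; exact: bigsetU_measurable.
rewrite EE (le_trans (measure_bigsetU_le _ _ _ mC))//.
rewrite (eq_bigr (fun=> (N.+1%:R^-1 ^+ n)%:E)); last by move=> v _; case: (PC v).
by rewrite sumEFin sumr_const exprVn mulr_natl.
Qed.

(** * Spacings of order statistics *)

Lemma order_stat_rank (R : realType) (n j : nat) (x : n.-tuple R) :
  injective (tnth x) -> (j < n)%N ->
  exists i, order_stat x j.+1 = tnth x i /\
    #|[set l | tnth x l < tnth x i]%SET| = j.
Proof.
move=> xI jn; set s := sort <=%R x.
have szs : size s = n by rewrite size_sort size_tuple.
have us : uniq s by rewrite sort_uniq; apply/tuple_uniqP.
have ss : sorted <%R s by rewrite lt_sorted_uniq_le us sort_le_sorted.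
have : nth 0 s j \in x by rewrite -(mem_sort <=%R) mem_nth ?szs.
move=> /tnthP[i xi]; exists i; split; first by rewrite -xi.
rewrite -[RHS](@count_lt_nth _ _ 0 s j ss) ?szs// xi.
rewrite (permP (permEl (perm_sort _ _))) -[X in count _ X]map_tnth_enum count_map.
by rewrite cardE -size_filter enumT; congr size; apply: eq_filter => l; rewrite !inE.
Qed.

Definition cells (R : realType) (n N : nat) (F : R -> R) (x : n.-tuple R) :
  {ffun 'I_n -> 'I_N.+1} := [ffun i => cell N (F (tnth x i))].

(** When the cells are distinct, they are ordered as the observations. *)
Lemma order_stat_cells (R : realType) (n N j : nat) (F : R -> R) (x : n.-tuple R) :
  {homo F : u v / u <= v} -> injectiveb (cells N F x) -> (j < n)%N ->
  exists i, order_stat x j.+1 = tnth x i /\ rank (cells N F x) i = j.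
Proof.
move=> Fle /injectiveP cI jn.
have xI : injective (tnth x).
  by move=> i i' eqx; apply: cI; rewrite !ffunE eqx.
have [i [-> <-]] := order_stat_rank xI jn.
exists i; split => //; rewrite /rank; congr (#|pred_of_set _|).
apply/setP => l; rewrite !inE.
have [->|li] := eqVneq l i; first by rewrite ltnn ltxx.
have cli : cells N F x l != cells N F x i.
  by apply: contra_neq li => /cI.
case: ltP => [lt|ge].
  rewrite ltn_neqAle cli /= !ffunE.
  by rewrite cell_le// Fle// ltW.
by apply/negbTE; rewrite -leqNgt !ffunE cell_le// Fle.
Qed.

Lemma card_between (n N : nat) (v : {ffun 'I_n -> 'I_N.+1}) (i k : 'I_n) :
  injectiveb v -> (v i < v k)%N ->
  (#|[set l | v i < v l < v k]%SET| + (rank v i).+1 = rank v k)%N.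
Proof.
move=> /injectiveP vI ik; rewrite /rank.
have -> : [set l | (v l < v k)%N]%SET =
    ([set l | (v i < v l < v k)%N] :|: (i |: [set l | (v l < v i)%N]))%SET.
  apply/setP => l; rewrite !inE -(inj_eq vI) -val_eqE.
  case: (ltngtP (v l) (v i)) => [li|il|->] /=; rewrite ?ik ?orbF//.
  by rewrite (ltn_trans li ik).
rewrite cardsU cardsU1 !inE ltnn add1n.
rewrite (_ : (_ :&: _)%SET = finset.set0) ?cards0 ?subn0//.
apply/setP => l; rewrite !inE -(inj_eq vI) -val_eqE.
by case: (ltngtP (v l) (v i)); rewrite ?andbF.
Qed.

(** The rounding to cells costs at most one unit at each end of the spacing,
    whence the shift by two in the second half. *)
Lemma spacing_cells (R : realType) (n N j r : nat) (F : R -> R) (x : n.-tuple R)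
    (t : R) (c := cells N F x)
    (D := F (order_stat x (j + r).+1) - F (order_stat x j.+1)) :
  {homo F : u v / u <= v} -> (forall u, 0 <= F u <= 1) ->
  injectiveb c -> (0 < r)%N -> (j + r < n)%N -> 0 <= t ->
  (t < D -> spacing_ge j (Num.truncn (N.+1%:R * t)) r c) /\
  (D < t -> ~~ spacing_ge j (Num.truncn (N.+1%:R * t)).+2 r c).
Proof.
move=> Fle F01 cI r0 jrn t0.
have jn : (j < n)%N by rewrite (leq_ltn_trans _ jrn) ?leq_addr.
have [i [xi ri]] := order_stat_cells Fle cI jn.
have [k [xk rk]] := order_stat_cells Fle cI jrn.
rewrite -/c in ri rk.
have ik : (c i < c k)%N.
  rewrite ltnNge; apply/negP => ki; suff : (rank c k <= rank c i)%N by rewrite ri rk; lia.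
  apply/subset_leq_card/fintype.subsetP => l; rewrite !inE => /leq_trans; exact.
have := card_between cI ik; rewrite ri rk => cb.
have M0 : 0 < N.+1%:R :> R by rewrite ltr0n.
have := cell_bounds N (F01 (tnth x i)); have := cell_bounds N (F01 (tnth x k)).
rewrite -[cell _ _ in X in X -> _](ffunE (fun i => cell N (F (tnth x i)))).
rewrite -[cell _ _ in X in _ -> X -> _](ffunE (fun i => cell N (F (tnth x i)))).
rewrite -/(cells N F x) -/c => /andP[k1 k2] /andP[i1 i2].
have /andP[q1 q2] := truncn_itv (mulr_ge0 (ltW M0) t0).
set q := Num.truncn _ in q1 q2 *.
rewrite /D xi xk; split => lt.
  have : (c i + q < (c k).+1)%N.
    rewrite -(ltr_nat R) natrD (lt_le_trans _ k2)//.
    move: lt; rewrite -(ltr_pM2l M0) mulrBr; lra.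
  rewrite ltnS => iqk; apply/existsP; exists i; rewrite ri eqxx /=.
  rewrite (leq_ltn_trans (n := #|[set l | (c i < c l < c k)%N]%SET|))//; last by lia.
  apply/subset_leq_card/fintype.subsetP => l; rewrite !inE.
  by move=> /andP[-> /leq_trans]; exact.
have ckq : (c k < c i + q.+2)%N.
  rewrite -(ltr_nat R) natrD (le_lt_trans k1)//.
  move: lt i2 q2; rewrite -(ltr_pM2l M0) mulrBr -!natr1; lra.
apply/existsP => -[i' /andP[/eqP ri']].
have -> : i' = i by apply: (rank_inj cI); rewrite ri ri'.
apply/negP; rewrite -leqNgt.
have <- : #|(k |: [set l | (c i < c l < c k)%N])%SET| = r.
  by rewrite cardsU1 !inE ltnn andbF; lia.
apply/subset_leq_card/fintype.subsetP => l; rewrite !inE.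
by move=> /predU1P[->|/andP[-> /ltn_trans]]; [rewrite ik|exact].
Qed.

Lemma few_below_tail (R : realType) (n N q r : nat) : (q <= N.+1)%N ->
  #|[set v : {ffun 'I_n -> 'I_N.+1} | ~~ few_below q r v]%SET|%:R / N.+1%:R ^+ n =
  (binom_tail R n r).[q%:R / N.+1%:R].
Proof.
move=> qN; rewrite card_few_below// natr_sum mulr_suml horner_sum.
apply: eq_big_nat => a /andP[_ an].
rewrite hornerZ hornerM !horner_exp hornerD hornerN hornerC hornerX.
rewrite natrM -mulrA; congr (_ * _); rewrite natrM !natrX natrB//.
have M0 : N.+1%:R != 0 :> R by rewrite pnatr_eq0.
rewrite -[X in _ / _ ^+ X](subnKC (_ : a <= n)%N) ?ltnS// exprD invfM mulrACA.
by rewrite -!expr_div_n mulrBl divff.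
Qed.

Lemma few_above_tail (R : realType) (n N q r : nat) : (q <= N.+1)%N ->
  #|[set v : {ffun 'I_n -> 'I_N.+1} | few_below q r v]%SET|%:R / N.+1%:R ^+ n =
  1 - (binom_tail R n r).[q%:R / N.+1%:R].
Proof.
move=> qN; rewrite -few_below_tail//.
have M0 : N.+1%:R ^+ n != 0 :> R by rewrite expf_neq0// pnatr_eq0.
apply: (mulIf M0); rewrite mulrBl mul1r !divfK//; apply/eqP; rewrite -subr_eq0 opprB.
rewrite addrA subr_eq0 -natrD -natrX eqr_nat.
rewrite -[X in (X ^ _)%N](card_ord N.+1) -[X in (_ ^ X)%N](card_ord n) -card_ffun.
rewrite -(cardsC [set v | few_below q r v]); apply/eqP; congr (_ + #|pred_of_set _|)%N.
by apply/setP => v; rewrite !inE.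
Qed.

(** The right-hand side tends to 0: a fine discretization separates the points. *)
Lemma card_not_distinct_nz_le (R : realType) (n N : nat) : (n <= N.+1)%N ->
  #|[set v : {ffun 'I_n -> 'I_N.+1} | ~~ distinct_nz v]%SET|%:R / N.+1%:R ^+ n
  <= 1 - (1 - n%:R / N.+1%:R) ^+ n :> R.
Proof.
move=> nN; have M0 : N.+1%:R != 0 :> R by rewrite pnatr_eq0.
have M0' : 0 < N.+1%:R ^+ n :> R by rewrite exprn_gt0// ltr0n.
rewrite ler_pdivrMr// mulrBl mul1r -exprMn mulrBl mul1r divfK// -natrB//.
rewrite lerBrDr -!natrX -natrD ler_nat.
rewrite -[X in (_ <= X ^ _)%N](card_ord N.+1) -[X in (_ <= _ ^ X)%N](card_ord n) -card_ffun.
rewrite -(cardsC [set v : {ffun 'I_n -> 'I_N.+1} | distinct_nz v]%SET) addnC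
  leq_add ?card_distinct_nz//.
by apply/eq_leq/eq_card => v; rewrite !inE.
Qed.

(** The event that the cells lie in [S N] for every [N] is the intersection of
    countably many measurable events, the [N]th one having probability at most
    [b N].  It serves to bound events, such as those defined through order
    statistics, without establishing their measurability. *)
Lemma cells_cover d (T : measurableType d) (R : realType)
    (P : probability T R) (n : nat) (X : 'I_n -> {RV P >-> R}) (f : R -> R)
    (S : forall N, {set {ffun 'I_n -> 'I_N.+1}}) (b : nat -> R) (p : R) :
  is_density f -> mutually_independent X -> (forall i, has_density (X i) f) ->
  (\forall N \near \oo, #|S N|%:R / N.+1%:R ^+ n <= b N) ->
  b N @[N --> \oo] --> p ->
  exists E, [/\ measurable E, (P E <= p%:E)%E & forall w,
    (forall N, cells N (density_cdf f) [tuple X i w | i < n] \in S N) -> E w].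
Proof.
move=> df hI hX Sb bp.
pose E N := [set w | [ffun i => cell N (density_cdf f (X i w))] \in S N].
have mE N : measurable (E N) /\ (P (E N) <= (#|S N|%:R / N.+1%:R ^+ n)%:E)%E.
  exact: prob_cells_le.
have mI : measurable (\bigcap_N E N) by apply: bigcap_measurable => // N _; case: (mE N).
exists (\bigcap_N E N); split => //.
  have PE : P (\bigcap_N E N) \is a fin_num by exact: fin_num_measure.
  rewrite -(fineK PE) lee_fin -(cvg_lim (@Rhausdorff R) bp).
  apply: limr_ge; first by apply/cvg_ex; exists p.
  apply: filterS Sb => N; apply: le_trans; rewrite -lee_fin fineK//.
  have [mEN PEN] := mE N; apply: le_trans PEN; apply: le_measure; rewrite ?inE//.
  exact: bigcap_inf.
move=> w h N _; rewrite /E /=; have := h N.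
rewrite (_ : cells _ _ _ = [ffun i => cell N (density_cdf f (X i w))])//.
by apply/ffunP => i; rewrite !ffunE tnth_mktuple.
Qed.

Lemma cvg_divS (R : realType) (a : R) : a / N.+1%:R @[N --> \oo] --> (0 : R).
Proof. by rewrite -[X in _ --> X](mulr0 a); apply: cvgMr; exact: cvg_harmonic. Qed.

Lemma cvg_truncn_div (R : realType) (t : R) : 0 <= t ->
  (Num.truncn (N.+1%:R * t))%:R / N.+1%:R @[N --> \oo] --> t.
Proof.
move=> t0; have M0 N : 0 < N.+1%:R :> R by rewrite ltr0n.
apply: (@squeeze_cvgr _ _ _ _ (fun N => t - 1 / N.+1%:R) (fun=> t)); last 2 first.
- by rewrite -[X in _ --> X]subr0; apply: cvgB; [exact: cvg_cst|exact: cvg_divS].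
- exact: cvg_cst.
near=> N; have /andP[q1 q2] := truncn_itv (mulr_ge0 (ltW (M0 N)) t0).
rewrite lerBlDr -mulrDl ler_pdivlMr// ler_pdivrMr// mulrC q1 andbT.
by rewrite natr1 ltW.
Unshelve. all: by end_near. Qed.

Lemma cvg_not_distinct_nz (R : realType) (n : nat) :
  1 - (1 - n%:R / N.+1%:R) ^+ n @[N --> \oo] --> (0 : R).
Proof.
rewrite -[X in _ --> X](subrr 1); apply: cvgB; first exact: cvg_cst.
rewrite -[X in _ --> X](expr1n _ n).
have c1 : 1 - n%:R / N.+1%:R @[N --> \oo] --> (1 : R).
  by rewrite -[X in _ --> X]subr0; apply: cvgB; [exact: cvg_cst|exact: cvg_divS].
exact: continuous_cvg (@exprn_continuous R n 1) c1.
Qed.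

Lemma ties_cover d (T : measurableType d) (R : realType)
    (P : probability T R) (n : nat) (X : 'I_n -> {RV P >-> R}) (f : R -> R) :
  is_density f -> mutually_independent X -> (forall i, has_density (X i) f) ->
  exists E, [/\ measurable E, P E = 0%E & forall w,
    ~ injective (fun i => X i w) -> E w].
Proof.
move=> df hI hX.
have [|E [mE PE hE]] := @cells_cover _ _ _ _ _ X f
  (fun N => [set v | ~~ distinct_nz v]%SET) _ 0 df hI hX _ (@cvg_not_distinct_nz R n).
  near=> N; apply: card_not_distinct_nz_le; apply: leqW; near: N; exact: nbhs_infty_ge.
exists E; split => //; first by apply/eqP; rewrite eq_le PE measure_ge0.
move=> w nI; apply: hE => N; rewrite inE; apply/negP => /andP[/injectiveP cI _].
apply: nI => i i' eqX; apply: cI; rewrite !ffunE !tnth_mktuple.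
by rewrite eqX.
Unshelve. all: by end_near. Qed.

Lemma spacing_upper d (T : measurableType d) (R : realType)
    (P : probability T R) (n : nat) (X : 'I_n -> {RV P >-> R}) (f : R -> R)
    (j r : nat) (t : R) :
  is_density f -> mutually_independent X -> (forall i, has_density (X i) f) ->
  (0 < r)%N -> (j + r < n)%N -> 0 <= t <= 1 ->
  let x := fun w => [tuple X i w | i < n] in
  exists E, [/\ measurable E, (P E <= (1 - (binom_tail R n r).[t])%:E)%E &
    forall w, t < density_cdf f (order_stat (x w) (j + r).+1) -
                  density_cdf f (order_stat (x w) j.+1) -> E w].
Proof.
move=> df hI hX r0 jrn /andP[t0 t1] x.
have i0 : 'I_n by exists 0%N; lia.
pose q N := Num.truncn (N.+1%:R * t).
have qN N : (q N <= N.+1)%N.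
  by rewrite -(ler_nat R) (le_trans _ (ler_piMr (ler0n _ N.+1) t1))// truncn_le mulr_ge0.
pose b N := 1 - (1 - n%:R / N.+1%:R) ^+ n +
            (1 - (binom_tail R n r).[(q N)%:R / N.+1%:R]).
have bt : b N @[N --> \oo] --> 1 - (binom_tail R n r).[t].
  rewrite -[X in _ --> X]add0r; apply: cvgD; first exact: cvg_not_distinct_nz.
  apply: cvgB; first exact: cvg_cst.
  exact: continuous_cvg (@continuous_horner R _ t) (cvg_truncn_div t0).
have [|E [mE PE hE]] := @cells_cover _ _ _ _ _ X f
  (fun N => [set v | ~~ distinct_nz v || spacing_ge j (q N) r v]%SET) b _ df hI hX _ bt.
  near=> N; have nN : (n <= N.+1)%N.
    by apply: leqW; near: N; exact: nbhs_infty_ge.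
  apply: le_trans (lerD (card_not_distinct_nz_le R nN) (lexx _)).
  rewrite -(few_above_tail R n r (qN N)) -mulrDl ler_pM2r ?invr_gt0 ?exprn_gt0 ?ltr0n//.
  rewrite -natrD ler_nat.
  have := card_spacing N (q N) true jrn.
  rewrite (_ : [set v | few_below _ r v == true]%SET =
      [set v | few_below (q N) r v]%SET); last first.
    by apply/setP => v; rewrite !inE eqb_id.
  move=> cs; apply: leq_trans (leq_add (leqnn _) cs).
  apply: leq_trans (leq_card_setU _ _); apply/subset_leq_card/fintype.subsetP => v.
  by rewrite !inE eqb_id; case: distinct_nz.
exists E; split => // w lt; apply: hE => N; rewrite inE -implyNb negbK.
apply/implyP => /andP[cI _].
have F01 u : 0 <= density_cdf f u <= 1 by exact: prim01 (hX i0).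
by have [+ _] := @spacing_cells R n N j r _ (x w) t (density_cdf_le df) F01 cI r0 jrn t0; exact.
Unshelve. all: by end_near. Qed.

Lemma spacing_lower d (T : measurableType d) (R : realType)
    (P : probability T R) (n : nat) (X : 'I_n -> {RV P >-> R}) (f : R -> R)
    (j r : nat) (t : R) :
  is_density f -> mutually_independent X -> (forall i, has_density (X i) f) ->
  (0 < r)%N -> (j + r < n)%N -> 0 <= t < 1 ->
  let x := fun w => [tuple X i w | i < n] in
  exists E, [/\ measurable E, (P E <= ((binom_tail R n r).[t])%:E)%E &
    forall w, density_cdf f (order_stat (x w) (j + r).+1) -
                  density_cdf f (order_stat (x w) j.+1) < t -> E w].
Proof.
move=> df hI hX r0 jrn /andP[t0 t1] x.
have i0 : 'I_n by exists 0%N; lia.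
pose q N := (Num.truncn (N.+1%:R * t)).+2.
have qt : (q N)%:R / N.+1%:R @[N --> \oo] --> t.
  rewrite -[X in _ --> X]addr0.
  under eq_fun do rewrite /q -addn2 natrD mulrDl.
  by apply: cvgD; [exact: cvg_truncn_div|exact: cvg_divS].
pose b N := 1 - (1 - n%:R / N.+1%:R) ^+ n +
            (binom_tail R n r).[(q N)%:R / N.+1%:R].
have bt : b N @[N --> \oo] --> (binom_tail R n r).[t].
  rewrite -[X in _ --> X]add0r; apply: cvgD; first exact: cvg_not_distinct_nz.
  exact: continuous_cvg (@continuous_horner R _ t) qt.
have [|E [mE PE hE]] := @cells_cover _ _ _ _ _ X f
  (fun N => [set v | ~~ distinct_nz v || ~~ spacing_ge j (q N) r v]%SET) b _ df hI hX _ bt.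
  near=> N; have nN : (n <= N.+1)%N.
    by apply: leqW; near: N; exact: nbhs_infty_ge.
  have qN : (q N <= N.+1)%N.
    rewrite -(ler_nat R) -[leRHS]mul1r -ler_pdivrMr ?ltr0n//.
    by near: N; exact: cvgr_le _ qt _ t1.
  apply: le_trans (lerD (card_not_distinct_nz_le R nN) (lexx _)).
  rewrite -(few_below_tail R n r qN) -mulrDl ler_pM2r ?invr_gt0 ?exprn_gt0 ?ltr0n//.
  rewrite -natrD ler_nat.
  have := card_spacing N (q N) false jrn.
  rewrite (_ : [set v | few_below _ r v == false]%SET =
      [set v | ~~ few_below (q N) r v]%SET); last first.
    by apply/setP => v; rewrite !inE eqbF_neg.
  move=> cs; apply: leq_trans (leq_add (leqnn _) cs).
  apply: leq_trans (leq_card_setU _ _); apply/subset_leq_card/fintype.subsetP => v.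
  by rewrite !inE eqbF_neg; case: distinct_nz.
exists E; split => // w lt; apply: hE => N; rewrite inE -implyNb negbK.
apply/implyP => /andP[cI _].
have F01 u : 0 <= density_cdf f u <= 1 by exact: prim01 (hX i0).
by have [_] := @spacing_cells R n N j r _ (x w) t (density_cdf_le df) F01 cI r0 jrn t0; exact.
Unshelve. all: by end_near. Qed.

(** * Log-concave densities between grid points *)

Definition exp_affine (R : realType) (p q a : R) (y : R) : R :=
  expR (p + q * (y - a)).

Lemma continuous_exp_affine (R : realType) (p q a : R) :
  continuous (exp_affine p q a).
Proof.
move=> y; apply: (@continuous_comp _ _ _ (fun y => p + q * (y - a)) expR).
  apply: cvgD; first exact: cvg_cst.
  by apply: cvgMr; apply: cvgB; [exact: cvg_id|exact: cvg_cst].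
exact: continuous_expR.
Qed.

Lemma integrable_exp_affine (R : realType) (p q a b c : R) :
  lebesgue_measure.-integrable `[b, c] (EFin \o exp_affine p q a).
Proof.
apply: continuous_compact_integrable; first exact: segment_compact.
exact/continuous_subspaceT/continuous_exp_affine.
Qed.

Lemma is_derive_exp_affine (R : realType) (p q a y : R) :
  q != 0 ->
  is_derive y 1 (fun y => q^-1 * exp_affine p q a y) (exp_affine p q a y).
Proof.
move=> q0.
have dA : is_derive y 1 (fun y => p + q * (y - a)) q.
  apply: is_derive_eq; rewrite /GRing.scale/=; ring.
have dE := is_derive1_comp (is_derive_expR _) dA.
have := @is_deriveZ _ _ _ _ q^-1 _ _ _ dE.
by rewrite /GRing.scale /= mulrC mulfK.
Qed.

Lemma Rintegral_exp_affine (R : realType) (p q a b : R) : a < b ->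
  \int[lebesgue_measure]_(y in `[a, b]) exp_affine p q a y =
  expR p * (if q == 0 then b - a else (expR (q * (b - a)) - 1) / q).
Proof.
move=> ab; have [->|q0] := eqVneq q 0.
  rewrite (@eq_Rintegral _ _ _ _ _ (fun=> expR p)); last first.
    by move=> y _; rewrite /exp_affine mul0r addr0.
  by rewrite Rintegral_cst//= lebesgue_measure_itv/= lte_fin ab -EFinB.
rewrite /Rintegral (@continuous_FTC2 _ _ (fun y => q^-1 * exp_affine p q a y)).
- rewrite -EFinB /= -mulrBr /exp_affine subrr mulr0 addr0 expRD.
  by rewrite -[X in _ - X]mulr1 -mulrBr mulrCA [X in _ * X]mulrC.
- exact: ab.
- exact/continuous_subspaceT/continuous_exp_affine.
- have cF : continuous (fun y => q^-1 * exp_affine p q a y).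
    by move=> y; apply: cvgMr; exact: continuous_exp_affine.
  split; last 2 first.
  + by apply: cvg_at_right_filter; exact: cF.
  + by apply: cvg_at_left_filter; exact: cF.
  + by move=> y _; have [] := is_derive_exp_affine p a y q0.
- move=> y _; rewrite derive1E.
  by have dy := is_derive_exp_affine p a y q0; rewrite derive_val.
Qed.

Lemma EfunE (R : realType) (s : R) :
  Efun s = if s == 0 then 1 else (expR s - 1) / s.
Proof.
have := @Rintegral_exp_affine R 0 s 0 1 ltr01.
rewrite expR0 mul1r subr0 mulr1 => <-; apply: eq_Rintegral => t _.
by rewrite /exp_affine add0r subr0.
Qed.

(** The exponential arc of slope [s] on the unit interval can be read from either
    end; this reduces tangents at a right end to tangents at a left end. *)
Lemma EfunN (R : realType) (s : R) : Efun (- s) = expR (- s) * Efun s.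
Proof.
rewrite !EfunE oppr_eq0; have [->|s0] := eqVneq s 0.
  by rewrite oppr0 expR0 mul1r.
by rewrite mulrA mulrBr mulr1 -expRD addNr expR0 invrN mulrN -mulNr opprB.
Qed.

Lemma Rintegral_Efun (R : realType) (p q a b : R) : a < b ->
  \int[lebesgue_measure]_(y in `[a, b]) exp_affine p q a y =
  expR p * (b - a) * Efun (q * (b - a)).
Proof.
move=> ab; rewrite Rintegral_exp_affine// EfunE mulf_eq0 (gt_eqF (_ : 0 < b - a)) ?subr_gt0//.
rewrite orbF -mulrA; have [_|q0] := eqVneq q 0; first by rewrite mulr1.
by field; rewrite q0 subr_eq0 gt_eqF.
Qed.

(** The chord inequality between points of positive density, where the exponent
    [phi] is finite and equal to [ln f]. *)
Lemma log_concave_ineq (R : realType) (f : R -> R) (x y t : R) :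
  log_concave f -> 0 < f x -> 0 < f y -> 0 <= t <= 1 ->
  0 < f ((1 - t) * x + t * y) /\
  (1 - t) * ln (f x) + t * ln (f y) <= ln (f ((1 - t) * x + t * y)).
Proof.
move=> [phi [phioo cphi fE]] fx fy t01.
have phiE z : 0 < f z -> phi z = (ln (f z))%:E.
  move=> fz; have := fE z; case: (phi z) (phioo z) => [r _|//|_].
    by move=> [->]; rewrite expRK.
  by move=> [] f0; move: fz; rewrite f0 ltxx.
have := cphi x y t t01; rewrite (phiE x fx) (phiE y fy) -!EFinM -EFinD.
have := fE ((1 - t) * x + t * y); have := phioo ((1 - t) * x + t * y).
case: (phi _) => [r _ [fz]|//|_ _]; last by rewrite leeNy_eq.
by rewrite lee_fin fz expRK expR_gt0.
Qed.

(** The slopes of the chords of [ln f] decrease. *)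
Lemma log_concave_slope (R : realType) (f : R -> R) (u y v : R) :
  log_concave f -> 0 < f u -> 0 < f y -> 0 < f v -> u < y -> y < v ->
  (ln (f v) - ln (f y)) / (v - y) <= (ln (f y) - ln (f u)) / (y - u).
Proof.
move=> lc fu fy fv uy yv.
have uv : 0 < v - u by rewrite subr_gt0 (lt_trans uy).
have t01 : 0 <= (y - u) / (v - u) <= 1.
  apply/andP; split; first by rewrite divr_ge0 ?ltW// subr_gt0.
  by rewrite ler_pdivrMr// mul1r lerD2r ltW.
have [_] := log_concave_ineq lc fu fv t01.
have -> : (1 - (y - u) / (v - u)) * u + (y - u) / (v - u) * v = y.
  by field; rewrite gt_eqF.
move=> h; rewrite ler_pdivrMr ?subr_gt0// mulrAC ler_pdivlMr ?subr_gt0//.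
move: h; rewrite -(ler_pM2r uv).
have -> : ((1 - (y - u) / (v - u)) * ln (f u) + (y - u) / (v - u) * ln (f v)) * (v - u)
  = (v - y) * ln (f u) + (y - u) * ln (f v).
  by field; rewrite gt_eqF.
move=> h; lra.
Qed.

(** The supremum of the slopes to the right of [y] is a supergradient: each slope
    to the left of [y] is an upper bound of them.  The points [x] and [z] make
    both sets of slopes nonempty, so that the supremum is finite. *)
Lemma log_concave_supergradient (R : realType) (f : R -> R) (x y z : R) :
  log_concave f -> 0 < f x -> 0 < f y -> 0 < f z -> x < y -> y < z ->
  exists g, forall u, 0 < f u -> ln (f u) <= ln (f y) + g * (u - y).
Proof.
move=> lc fx fy fz xy yz.
pose S := [set (ln (f v) - ln (f y)) / (v - y) | v in [set v | y < v /\ 0 < f v]].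
have S0 : S !=set0 by exists ((ln (f z) - ln (f y)) / (z - y)), z.
have ubS u : u < y -> 0 < f u -> ubound S ((ln (f y) - ln (f u)) / (y - u)).
  by move=> uy fu _ [v [yv fv] <-]; exact: log_concave_slope.
exists (sup S) => u fu; rewrite -lerBlDl.
have [uy|yu|->] := ltgtP u y; last by rewrite !subrr mulr0.
- have := sup_le_ub S0 (ubS u uy fu).
  rewrite ler_pdivlMr ?subr_gt0// => h; lra.
- rewrite -ler_pdivrMr ?subr_gt0//; apply: ub_le_sup; last by exists u.
  by exists ((ln (f y) - ln (f x)) / (y - x)); exact: ubS.
Qed.

Lemma density_cdf_diff_le_tangent (R : realType) (f : R -> R) (p q a b : R) :
  is_density f -> a < b -> (forall u, 0 < f u -> ln (f u) <= p + q * (u - a)) ->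
  density_cdf f b - density_cdf f a <= expR p * (b - a) * Efun (q * (b - a)).
Proof.
move=> df ab fle; rewrite (density_cdf_diff df (ltW ab)) -Rintegral_Efun//.
apply: le_Rintegral => //.
- exact: density_integrable.
- exact: integrable_exp_affine.
move=> y _; have [_ f0 _] := df; have := f0 y; rewrite le_eqVlt => /predU1P[<-|fy].
  exact: expR_ge0.
by rewrite -[f y]lnK ?posrE// ler_expR fle.
Qed.

Lemma chord_le_density_cdf_diff (R : realType) (f : R -> R) (a b : R) :
  is_density f -> log_concave f -> a < b -> 0 < f a -> 0 < f b ->
  expR (ln (f a)) * (b - a) * Efun (ln (f b) - ln (f a)) <= density_cdf f b - density_cdf f a.
Proof.
move=> df lc ab fa fb; have ba : 0 < b - a by rewrite subr_gt0.
have {1}-> : ln (f b) - ln (f a) = (ln (f b) - ln (f a)) / (b - a) * (b - a).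
  by rewrite divfK// gt_eqF.
rewrite (density_cdf_diff df (ltW ab)) -Rintegral_Efun//.
apply: le_Rintegral => //.
- exact: integrable_exp_affine.
- exact: density_integrable.
move=> y; rewrite /= in_itv/= => /andP[ay yb].
have t01 : 0 <= (y - a) / (b - a) <= 1.
  apply/andP; split; first by rewrite divr_ge0 ?subr_ge0 ?(ltW ab).
  by rewrite ler_pdivrMr// mul1r lerD2r.
have := log_concave_ineq lc fa fb t01.
have -> : (1 - (y - a) / (b - a)) * a + (y - a) / (b - a) * b = y.
  by field; rewrite gt_eqF.
move=> [fy le]; rewrite -[f y]lnK ?posrE// ler_expR; apply: le_trans le.
by rewrite le_eqVlt; apply/orP; left; apply/eqP; field; rewrite gt_eqF.
Qed.

Lemma ith_map (R : realType) (m : nat) (x : m.-tuple R) (F : R -> R) (i : nat) :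
  (1 <= i <= m)%N -> ith [tuple of [seq F y | y <- x]] i = F (ith x i).
Proof. by move=> im; rewrite /ith (nth_map 0) ?size_tuple//; lia. Qed.

Lemma ith_mktuple (R : realType) (m : nat) (G : nat -> R) (i : nat) :
  (1 <= i <= m)%N -> ith [tuple G k.+1 | k < m] i = G i.
Proof.
case: i => // i im; have im' : (i < m)%N by lia.
by rewrite /ith /= (nth_mktuple (fun k : 'I_m => G k.+1) 0 (Ordinal im')).
Qed.

(** The supergradients at the interior grid points serve as slopes.  The
    definitions of [Uint] and [Vint] use [g] at interior grid points only,
    which is where log-concavity provides one. *)
Lemma log_concave_grid (R : realType) (n : nat) (f : R -> R)
    (x : (mn R n).-tuple R) (l := [tuple of [seq ln (f y) | y <- x]]) :
  is_density f -> log_concave f -> (2 < mn R n)%N ->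
  (forall i, (1 <= i <= mn R n)%N -> 0 < f (ith x i)) ->
  (forall i, (1 <= i < mn R n)%N -> ith x i < ith x i.+1) ->
  exists g : ((mn R n).-1).-tuple R, C1 x l g /\
    forall i, (1 <= i <= (mn R n).-1)%N ->
      [/\ Lint x l i <= density_cdf f (ith x i.+1) - density_cdf f (ith x i),
          density_cdf f (ith x i.+1) - density_cdf f (ith x i) <= Uint x l g i &
          density_cdf f (ith x i.+1) - density_cdf f (ith x i) <= Vint x l g i].
Proof.
set m := mn R n in x l * => df lc m2 fx xlt.
have lE i : (1 <= i <= m)%N -> ith l i = ln (f (ith x i)) by exact: ith_map.
have exG (i : nat) : exists gi, (2 <= i <= m.-1)%N ->
    forall u, 0 < f u -> ln (f u) <= ith l i + gi * (u - ith x i).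
  have [im|im] := boolP (2 <= i <= m.-1)%N; last by exists 0.
  have [|||||g hg] := @log_concave_supergradient R f (ith x i.-1) (ith x i) (ith x i.+1) lc.
  - by apply: fx; lia.
  - by apply: fx; lia.
  - by apply: fx; lia.
  - by have := xlt i.-1; rewrite prednK; [apply; lia|lia].
  - by apply: xlt; lia.
  exists g => _ u fu; rewrite lE; last by lia.
  exact: hg.
have [G hG] := choice exG.
pose g := [tuple G k.+1 | k < m.-1].
have gE i : (1 <= i <= m.-1)%N -> ith g i = G i by exact: ith_mktuple.
have left_ge i : (2 <= i <= m.-1)%N ->
    density_cdf f (ith x i.+1) - density_cdf f (ith x i) <= tangent_left x l g i.
  move=> im; apply: density_cdf_diff_le_tangent => //; first by apply: xlt; lia.
  by move=> u fu; rewrite gE; [exact: hG|lia].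
have right_ge i : (1 <= i < m.-1)%N ->
    density_cdf f (ith x i.+1) - density_cdf f (ith x i) <= tangent_right x l g i.
  move=> im; have xi : ith x i < ith x i.+1 by apply: xlt; lia.
  rewrite /tangent_right -(opprB (ith x i.+1) (ith x i)) mulrN EfunN.
  (* Rewrite the tangent at the right end as an exponential arc issued from the
     left end, where its log-value is [ith l i.+1 - s]. *)
  set s := ith g i.+1 * _.
  have -> : expR (ith l i.+1) * (ith x i.+1 - ith x i) * (expR (- s) * Efun s)
    = expR (ith l i.+1 - s) * (ith x i.+1 - ith x i) * Efun s by rewrite expRD; ring.
  apply: density_cdf_diff_le_tangent => // u fu.
  rewrite (le_trans (hG i.+1 _ u fu)) -?gE; try lia.
  by rewrite /s le_eqVlt; apply/orP; left; apply/eqP; ring.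
exists g; split.
  move=> i j im ij; rewrite gE; last by lia.
  rewrite [ith l j]lE; last by lia.
  by apply: hG => //; apply: fx; lia.
move=> i im; split.
- have := @chord_le_density_cdf_diff R f (ith x i) (ith x i.+1) df lc.
  rewrite /Lint !lE; try lia; rewrite [X in X * Efun _]mulrC; apply.
  + by apply: xlt; lia.
  + by apply: fx; lia.
  + by apply: fx; lia.
- rewrite /Uint -/m; case: eqP => [|/eqP] im'; [apply: left_ge|apply: right_ge]; lia.
- rewrite /Vint; case: eqP => [|/eqP] im'; [apply: right_ge|apply: left_ge]; lia.
Qed.

(** * Densities with prescribed values *)

(** A single point is negligible for the Lebesgue measure. *)
Lemma density_override (R : realType) (h : R -> R) (a v : R) :
  is_density h -> 0 <= v -> is_density (fun y => if y == a then v else h y).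
Proof.
move=> [mh h0 h1] v0; have mH : measurable_fun setT (fun y => if y == a then v else h y).
  by apply: measurable_fun_ifT => //; exact: measurable_fun_eqr.
have H0 y : 0 <= (if y == a then v else h y) by case: ifP.
split=> //;
rewrite -h1; apply: ge0_ae_eq_integral => //=.
- exact/measurable_EFinP.
- exact/measurable_EFinP.
- by move=> y _; rewrite lee_fin.
- by move=> y _; rewrite lee_fin.
- exists [set a]; split => //; first exact: lebesgue_measure_set1.
  move=> y /= yn; apply: contrapT => ya; apply: yn => _.
  by rewrite ifN//; apply/eqP.
Qed.

Lemma density_interpolation (R : realType) (F : R -> R) (s : seq R) :
  (forall y, 0 <= F y) ->
  exists h, is_density h /\ {in s, forall y, h y = F y}.
Proof.
move=> F0; elim: s => [|a s [h [dh hF]]].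
  exists (uniform_pdf 0 1); split => //; split => //.
  - exact: measurable_uniform_pdf.
  - by move=> x; exact: uniform_pdf_ge0.
  - exact: integral_uniform_pdf1.
exists (fun y => if y == a then F a else h y).
split; first exact: density_override.
move=> y; rewrite inE; case: eqVneq => [->//|_ /=]; exact: hF.
Qed.

(** The constraints see a density only through its values on the grid, and these
    can be prescribed when the grid points are distinct. *)
Lemma ell_values_Ctilde (R : realType) (n : nat) (alpha : R)
    (x : (mn R n).-tuple R) (i : nat) : uniq x -> (1 <= i <= mn R n)%N ->
  ell_values alpha x i = [set (ln (h (ith x i)))%:E | h in Ctilde alpha x].
Proof.
move=> ux im; apply/seteqP; split => [_ [l [g [fs ->]]]|_ [h [_ [_ [g fs]]] <-]];
  last by exists [tuple of [seq ln (h y) | y <- x]], g; split; rewrite ?ith_map.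
have [h [dh hE]] := @density_interpolation R (fun y => expR (nth 0 l (index y x))) x
  (fun y => expR_ge0 _).
have lE : [tuple of [seq ln (h y) | y <- x]] = l.
  apply: eq_from_tnth => k; rewrite tnth_map hE ?mem_tnth// expRK.
  by rewrite (tnth_nth 0 x) index_uniq ?size_tuple// -tnth_nth.
exists h; last by rewrite -lE ith_map.
split=> //; split; last by exists g; rewrite lE.
move=> k km; rewrite hE ?expR_gt0//; apply: mem_nth; rewrite size_tuple; lia.
Qed.

(** * The grid of order statistics *)

Lemma order_stat_lt (R : realType) (n a b : nat) (x : n.-tuple R) :
  injective (tnth x) -> (1 <= a)%N -> (a < b)%N -> (b <= n)%N ->
  order_stat x a < order_stat x b.
Proof.
move=> xI a1 ab bn.
have ss : sorted <%R (sort <=%R x).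
  by rewrite lt_sorted_uniq_le sort_uniq sort_le_sorted andbT; apply/tuple_uniqP.
rewrite /order_stat /ith; apply: (sorted_ltn_nth lt_trans) => //;
  rewrite ?inE ?size_sort ?size_tuple; lia.
Qed.

Lemma ith_grid (R : realType) (n : nat) (s : n.-tuple R) (i : nat) :
  (1 <= i <= mn R n)%N -> ith (grid s) i = order_stat s (1 + i.-1 * 2 ^ sn R n).
Proof. exact: (@ith_mktuple R _ (fun k => order_stat s (1 + k.-1 * 2 ^ sn R n))). Qed.

Lemma grid_index_le (R : realType) (n i : nat) : (0 < n)%N ->
  (i <= (mn R n).-1)%N -> (1 + i * 2 ^ sn R n <= n)%N.
Proof.
move=> n0; rewrite /mn /= leq_divRL ?expn_gt0//; lia.
Qed.

Lemma grid_lt (R : realType) (n : nat) (s : n.-tuple R) (i : nat) : (0 < n)%N ->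
  injective (tnth s) -> (1 <= i < mn R n)%N ->
  ith (grid s) i < ith (grid s) i.+1.
Proof.
move=> n0 sI im; rewrite !ith_grid; try lia.
apply: order_stat_lt => //; last by apply: grid_index_le; lia.
by rewrite ltn_add2l ltn_pmul2r ?expn_gt0//; lia.
Qed.

Lemma grid_uniq (R : realType) (n : nat) (s : n.-tuple R) : (0 < n)%N ->
  injective (tnth s) -> uniq (grid s).
Proof.
move=> n0 sI; apply/tuple_uniqP.
have lt_grid (i i' : 'I_(mn R n)) : (i < i')%N -> tnth (grid s) i < tnth (grid s) i'.
  move=> ii'; rewrite !tnth_mktuple; apply: order_stat_lt => //.
    by rewrite ltn_add2l ltn_pmul2r ?expn_gt0.
  by apply: grid_index_le => //; rewrite -ltnS prednK.
move=> i i' eqg; apply/val_inj/eqP => /=.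
by case: ltngtP => // /lt_grid; rewrite eqg ltxx.
Qed.

Lemma grid_mem (R : realType) (n : nat) (s : n.-tuple R) (i : nat) : (0 < n)%N ->
  injective (tnth s) -> (1 <= i <= mn R n)%N ->
  exists k, ith (grid s) i = tnth s k.
Proof.
move=> n0 sI im; have lt : (i.-1 * 2 ^ sn R n < n)%N.
  by apply: grid_index_le => //; lia.
have [k [kE _]] := order_stat_rank sI lt.
by exists k; rewrite ith_grid.
Qed.

(** The condition on [Bmax] says that [n] is at least [8 * 2 ^ sn]. *)
Lemma mn_gt2 (R : realType) (n : nat) : (2 <= n)%N -> 0 <= Bmax R n ->
  (2 < mn R n)%N.
Proof.
move=> n2; rewrite /Bmax subr_ge0 => h.
have ln2 : 0 < ln (2 : R) by rewrite ln_gt0// ltr1n.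
have n8 : 0 < (n%:R / 8 : R) by rewrite divr_gt0// ltr0n; lia.
have : ((sn R n)%:R : R) <= log2 (n%:R / 8).
  by rewrite -[X in X <= _]/((sn R n)%:Z%:~R) (le_trans _ (floor_le _)) ?ler_int.
rewrite /log2 ler_pdivlMr// (mulr_natl (ln 2)) -lnXn// ler_ln ?posrE ?exprn_gt0//.
rewrite ler_pdivlMr ?ltr0n// -natrX -natrM ler_nat => n8'.
rewrite /mn ltnS leq_divRL ?expn_gt0//.
have : (0 < 2 ^ sn R n)%N by rewrite expn_gt0.
by move: (2 ^ sn R n)%N n8' => p; lia.
Qed.

(** The bound comes from [tn], which is at least its term of index [B]. *)
Lemma level01 (R : realType) (n : nat) (alpha : R) (B : nat) :
  0 < alpha < 1 -> (B <= `|Bmax R n|)%N -> (0 < nB R n B)%N ->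
  0 < levelB n alpha B < 1.
Proof.
move=> /andP[a0 a1] Bb nB0.
have tB : (B + 2)%:R^-1 <= tn R n.
  rewrite /tn (bigD1_seq B) ?mem_index_iota ?iota_uniq//=.
  by rewrite lerDl sumr_ge0// => k _; rewrite invr_ge0.
have B2 : 0 < (B + 2)%:R :> R by rewrite ltr0n; lia.
have BT : 1 <= (B + 2)%:R * tn R n by rewrite -ler_pdivrMl// mulr1.
have N1 : 1 <= (nB R n B)%:R :> R by rewrite ler1n.
have D2 : 2 <= 2 * (B + 2)%:R * (nB R n B)%:R * tn R n.
  have : 1 * 1 <= (nB R n B)%:R * ((B + 2)%:R * tn R n) by apply: ler_pM.
  lra.
by rewrite /levelB divr_gt0 ?ltr_pdivrMr//=; lra.
Qed.

Lemma tn_gt0 (R : realType) (n : nat) : 0 < tn R n.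
Proof.
by rewrite /tn big_nat_recl//= ltr_pwDl// ?invr_gt0 ?ltr0n// sumr_ge0.
Qed.

(** There are [nB] blocks of level [B], with two tails each; by the choice of
    [levelB] they contribute [alpha / ((B + 2) * tn)], and [tn] normalizes the
    sum over [B]. *)
Lemma level_sum (R : realType) (n : nat) (alpha : R) : 0 <= alpha ->
  \sum_(0 <= B < `|Bmax R n|.+1)
    (nB R n B)%:R * (2 * levelB n alpha B) <= alpha.
Proof.
move=> a0; have t0 := tn_gt0 R n.
apply: (@le_trans _ _ (alpha / tn R n * tn R n)); last by rewrite divfK// gt_eqF.
rewrite [X in _ <= _ * X]/tn mulr_sumr; apply: ler_sum => B _.
have B2 : B%:R + 2 != 0 :> R by rewrite -natrD pnatr_eq0; lia.
have [->|nB0] := eqVneq ((nB R n B)%:R : R) 0.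
  by rewrite mul0r mulr_ge0 ?divr_ge0 ?invr_ge0// ltW.
rewrite le_eqVlt; apply/orP; left; apply/eqP; rewrite /levelB.
by field; rewrite nB0 B2 gt_eqF.
Qed.

(** * Coverage *)

Lemma spacing_level d (T : measurableType d) (R : realType)
    (P : probability T R) (n : nat) (X : 'I_n -> {RV P >-> R}) (f : R -> R)
    (j r : nat) (g : R) :
  is_density f -> mutually_independent X -> (forall i, has_density (X i) f) ->
  (0 < r)%N -> (j + r < n)%N -> 0 < g < 1 ->
  let x := fun w => [tuple X i w | i < n] in
  exists E, [/\ measurable E, (P E <= (2 * g)%:E)%E & forall w, ~ E w ->
    qBeta g r (n + 1 - r)
      <= density_cdf f (order_stat (x w) (j + r).+1) - density_cdf f (order_stat (x w) j.+1)
      <= qBeta (1 - g) r (n + 1 - r)].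
Proof.
move=> df hI hX r0 jrn g01 x; have /andP[g0 g1] := g01.
have rn : (0 < r <= n)%N by lia.
have [/andP[c0 c1] cg] := qBetaP rn g01.
have [d01 dg] : 0 <= qBeta (1 - g) r (n + 1 - r) <= 1 /\
    (binom_tail R n r).[qBeta (1 - g) r (n + 1 - r)] = 1 - g.
  by apply: qBetaP => //; lra.
have c01 : 0 <= qBeta g r (n + 1 - r) < 1.
  rewrite c0 lt_neqAle c1 andbT; apply/eqP => ceq.
  by move: cg g1; rewrite ceq binom_tail1 => [<-|]; [rewrite ltxx|lia].
have [E1 [mE1 PE1 hE1]] := spacing_lower df hI hX r0 jrn c01.
have [E2 [mE2 PE2 hE2]] := spacing_upper df hI hX r0 jrn d01.
exists (E1 `|` E2); split; first exact: measurableU.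
  apply: le_trans (measureU2 _ mE1 mE2) _.
  rewrite cg in PE1; rewrite dg opprB addrC subrK in PE2.
  by rewrite (_ : 2 * g = g + g) ?EFinD ?leeD//; ring.
move=> w nE; apply/andP; split; rewrite leNgt; apply/negP => lt; apply: nE.
  by left; exact: hE1.
by right; exact: hE2.
Qed.

Lemma density_zero_null d (T : measurableType d) (R : realType)
    (P : probability T R) (X : {RV P >-> R}) (f : R -> R) :
  is_density f -> has_density X f ->
  measurable (X @^-1` [set x | f x = 0]) /\ P (X @^-1` [set x | f x = 0]) = 0%E.
Proof.
move=> [mf _ _] hX.
have mZ : measurable [set x | f x = 0].
  rewrite (_ : [set _ | _] = setT `&` f @^-1` [set 0]); first exact: mf.
  by rewrite setTI.
split; first by rewrite -[X in measurable X]setTI; exact: measurable_funP.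
rewrite -[LHS]/(distribution P X _) hX// integral0_eq// => x /= ->.
by [].
Qed.

(** The complement of [G] is the union of the ties, of the zeros of [f], and of
    the covers of the blocks that violate their bounds. *)
Lemma good_event d (T : measurableType d) (R : realType)
    (P : probability T R) (n : nat) (alpha : R) (f : R -> R)
    (X : 'I_n -> {RV P >-> R}) :
  0 < alpha < 1 -> is_density f -> mutually_independent X ->
  (forall i, has_density (X i) f) ->
  let x := fun w => [tuple X i w | i < n] in
  exists G, [/\ measurable G, ((1 - alpha)%:E <= P G)%E & forall w, G w ->
    [/\ injective (tnth (x w)), (forall i, 0 < f (tnth (x w) i)) &
    forall B i, (B <= `|Bmax R n|)%N -> (i < nB R n B)%N ->
      cB n alpha B
        <= density_cdf f (order_stat (x w) (i * 2 ^ (B + sn R n) + 2 ^ (B + sn R n)).+1)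
           - density_cdf f (order_stat (x w) (i * 2 ^ (B + sn R n)).+1)
        <= dB n alpha B]].
Proof.
move=> a01 df hI hX x.
have [E0 [mE0 PE0 hE0]] := ties_cover df hI hX.
pose Z := \big[setU/set0]_(i < n) (X i @^-1` [set x | f x = 0]).
have mZ i : measurable (X i @^-1` [set x | f x = 0]).
  by case: (density_zero_null df (hX i)).
have exE (Bi : nat * nat) : exists E, measurable E /\
    ((Bi.1 <= `|Bmax R n|)%N /\ (Bi.2 < nB R n Bi.1)%N ->
     (P E <= (2 * levelB n alpha Bi.1)%:E)%E /\ forall w, ~ E w ->
      cB n alpha Bi.1
        <= density_cdf f (order_stat (x w) (Bi.2 * 2 ^ (Bi.1 + sn R n) + 2 ^ (Bi.1 + sn R n)).+1)
           - density_cdf f (order_stat (x w) (Bi.2 * 2 ^ (Bi.1 + sn R n)).+1)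
        <= dB n alpha Bi.1).
  case: Bi => B i /=; have [[Bb iB]|nv] := pselect ((B <= `|Bmax R n|)%N /\ (i < nB R n B)%N);
    last by exists set0; split.
  have jrn : (i * 2 ^ (B + sn R n) + 2 ^ (B + sn R n) < n)%N.
    have : (i.+1 * 2 ^ (B + sn R n) <= n.-1)%N by rewrite -leq_divRL ?expn_gt0.
    rewrite mulSn addnC; have : (0 < 2 ^ (B + sn R n))%N by rewrite expn_gt0.
    by move: (2 ^ _)%N (_ * _)%N => p q; lia.
  have r0 : (0 < 2 ^ (B + sn R n))%N by rewrite expn_gt0.
  have g01 := level01 a01 Bb (leq_ltn_trans (leq0n i) iB).
  have [E [mE PE hE]] := spacing_level df hI hX r0 jrn g01.
  by exists E; split.
have [E hE] := choice exE.
have mE Bi : measurable (E Bi) by case: (hE Bi).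
pose W := \big[setU/set0]_(0 <= B < `|Bmax R n|.+1)
            \big[setU/set0]_(0 <= i < nB R n B) E (B, i).
have mW' B : measurable (\big[setU/set0]_(0 <= i < nB R n B) E (B, i)).
  exact: bigsetU_measurable.
have mW : measurable W by exact: bigsetU_measurable.
have mZZ : measurable Z by exact: bigsetU_measurable.
have PZ : P Z = 0%E.
  apply/eqP; rewrite eq_le measure_ge0 andbT.
  rewrite (le_trans (measure_bigsetU_le _ _ _ mZ))// big1// => i _.
  by case: (density_zero_null df (hX i)).
have PW : (P W <= alpha%:E)%E.
  have a0 : 0 <= alpha by case/andP: a01 => /ltW.
  apply: (@le_trans _ _ (\sum_(0 <= B < `|Bmax R n|.+1)
    (nB R n B)%:R * (2 * levelB n alpha B))%:E); last by rewrite lee_fin level_sum.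
  rewrite (le_trans (measure_bigsetU_le _ _ _ mW'))// -sumEFin.
  rewrite big_nat_cond [leRHS]big_nat_cond; apply: lee_sum => B /andP[/andP[_ Bb] _].
  rewrite (le_trans (measure_bigsetU_le _ _ _ (fun i => mE (B, i))))//.
  have -> : ((nB R n B)%:R * (2 * levelB n alpha B))%:E =
      (\sum_(0 <= i < nB R n B) (2 * levelB n alpha B)%:E)%E.
    by rewrite sumEFin big_const_nat iter_addr_0 subn0 mulr_natl.
  rewrite big_nat_cond [leRHS]big_nat_cond; apply: lee_sum => i /andP[/andP[_ iB] _].
  by have [_ []] := hE (B, i).
have mU : measurable (E0 `|` (Z `|` W)) by do 2?apply: measurableU.
exists (~` (E0 `|` (Z `|` W))); split; first exact: measurableC.
  rewrite probability_setC// EFinB leeB//.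
  apply: (@le_trans _ _ (P E0 + (P Z + P W))%E); last by rewrite PE0 PZ !add0e.
  apply: le_trans (measureU2 _ mE0 (measurableU _ _ mZZ mW)) _.
  by rewrite leeD2l//; exact: measureU2.
move=> w nU; have xE i : tnth (x w) i = X i w by rewrite tnth_mktuple.
split.
- apply: contrapT => nI; apply: nU; left; apply: hE0 => XI; apply: nI => i i'.
  by rewrite !xE; exact: XI.
- move=> i; rewrite xE lt_neqAle; have [_ -> _] := df; rewrite andbT.
  apply/negP => /eqP f0; apply: nU; right; left.
  by rewrite /Z (bigD1 i)//=; left.
- move=> B i Bb iB; have [_ /(_ (conj Bb iB))[_]] := hE (B, i); apply.
  move=> Ew; apply: nU; right; right.
  rewrite /W (bigD1_seq B) ?mem_index_iota ?iota_uniq//=; left.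
  by rewrite (bigD1_seq i) ?mem_index_iota ?iota_uniq//=; left.
Qed.

(** Over a block the masses of the grid intervals telescope to the spacing that
    [cB] and [dB] bound; the inequalities of [log_concave_grid] are summed. *)
Lemma good_Ctilde (R : realType) (n : nat) (alpha : R) (f : R -> R) (s : n.-tuple R) :
  (2 <= n)%N -> 0 <= Bmax R n -> is_density f -> log_concave f ->
  injective (tnth s) -> (forall i, 0 < f (tnth s i)) ->
  (forall B i, (B <= `|Bmax R n|)%N -> (i < nB R n B)%N ->
      cB n alpha B
        <= density_cdf f (order_stat s (i * 2 ^ (B + sn R n) + 2 ^ (B + sn R n)).+1)
           - density_cdf f (order_stat s (i * 2 ^ (B + sn R n)).+1)
        <= dB n alpha B) ->
  Ctilde alpha (grid s) f.
Proof.
move=> n2 hB df lc sI fs cd.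
have n0 : (0 < n)%N by lia.
have m2 := mn_gt2 n2 hB.
have fx i : (1 <= i <= mn R n)%N -> 0 < f (ith (grid s) i).
  by move=> im; have [k ->] := grid_mem n0 sI im.
have xlt i : (1 <= i < mn R n)%N -> ith (grid s) i < ith (grid s) i.+1.
  exact: grid_lt.
have [g [hC1 hUVL]] := log_concave_grid df lc m2 fx xlt.
split=> //; split=> //; exists g.
have blk B j k : B%:Z <= Bmax R n -> IB R n B (j, k) ->
    [/\ (1 <= j)%N, (k <= mn R n)%N &
     cB n alpha B <= \sum_(j <= i < k)
       (density_cdf f (ith (grid s) i.+1) - density_cdf f (ith (grid s) i)) <= dB n alpha B].
  move=> Bb [i [/andP[i1 iB] [-> ->]]].
  have Bb' : (B <= `|Bmax R n|)%N by lia.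
  have km : (1 + i * 2 ^ B <= mn R n)%N.
    rewrite /mn add1n ltnS leq_divRL ?expn_gt0// -mulnA -expnD.
    by rewrite -leq_divRL ?expn_gt0.
  have jk : (1 + (i - 1) * 2 ^ B <= 1 + i * 2 ^ B)%N.
    by rewrite leq_add2l leq_mul2r leq_subr orbT.
  split=> //; rewrite (telescope_sumr (fun i => density_cdf f (ith (grid s) i)))//.
  have := cd B i.-1 Bb'; rewrite prednK// => /(_ iB).
  rewrite !ith_grid ?km ?(leq_trans jk)// !add1n /= -!mulnA -!expnD subn1.
  rewrite -[in X in order_stat s X.+1](mulSnr i.-1) prednK//.
split.
- exact: hC1.
- move=> B j k Bb /(blk _ _ _ Bb)[j1 km /andP[le _]].
  apply: le_trans le _; apply: ler_sum_nat => i /andP[ji ik].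
  by have [|] := hUVL i; [lia|].
- move=> B j k Bb /(blk _ _ _ Bb)[j1 km /andP[le _]].
  apply: le_trans le _; apply: ler_sum_nat => i /andP[ji ik].
  by have [|] := hUVL i; [lia|].
- move=> B j k Bb /(blk _ _ _ Bb)[j1 km /andP[_ le]].
  apply: le_trans _ le; apply: ler_sum_nat => i /andP[ji ik].
  by have [|] := hUVL i; [lia|].
Qed.

Theorem proposition1 (d : measure_display) (T : measurableType d)
    (R : realType) (P : probability T R) (n : nat) (alpha : R) (f : R -> R)
    (X : 'I_n -> {RV P >-> R})
    (hn : (2 <= n)%N) (hB : 0 <= Bmax R n)
    (halpha : 0 < alpha < 1)
    (hf : is_density f) (hlc : log_concave f)
    (hindep : mutually_independent X)
    (hdens : forall i, has_density (X i) f) :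
  let x := fun w : T => grid [tuple X i w | i < n] in
  [/\ prob_ge P [set w | Ctilde alpha (x w) f] (1 - alpha),
      prob_ge P
        [set w | forall i : nat, (1 <= i <= mn R n)%N ->
           (expeR (ell_hat alpha (x w) i) <= (f (ith (x w) i))%:E
            <= expeR (mu_hat alpha (x w) i))%E] (1 - alpha) &
      {ae P, forall w, forall i : nat, (1 <= i <= mn R n)%N ->
         ell_hat alpha (x w) i =
           ereal_inf [set (ln (h (ith (x w) i)))%:E
                     | h in Ctilde alpha (x w)] /\
         mu_hat alpha (x w) i =
           ereal_sup [set (ln (h (ith (x w) i)))%:E
                     | h in Ctilde alpha (x w)]}].
Proof.
move=> x; have n0 : (0 < n)%N by lia.
have [G [mG PG hG]] := good_event halpha hf hindep hdens.
have GC w : G w -> Ctilde alpha (x w) f.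
  by move=> /hG[XI f0 cd]; apply: good_Ctilde.
split.
- by exists G.
- exists G; split => // w /GC [_ [f0 [g fg]]] i im.
  have fE : (f (ith (x w) i))%:E = expeR (ln (f (ith (x w) i)))%:E.
    by rewrite /= lnK// posrE f0.
  have fV : ell_values alpha (x w) i (ln (f (ith (x w) i)))%:E.
    by exists [tuple of [seq ln (f y) | y <- x w]], g; rewrite ith_map.
  rewrite fE !lee_expeR; apply/andP; split.
    exact: ereal_inf_lbound.
  exact: ereal_sup_ubound.
- have [E [mE PE hE]] := ties_cover hf hindep hdens.
  exists E; split => // w /= nw; apply: contrapT => nE; apply: nw => i im.
  have XI : injective (tnth [tuple X i w | i < n]).
    apply: contrapT => nI; apply: nE; apply: hE => XI; apply: nI => k k'.
    by rewrite !tnth_mktuple; exact: XI.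
  by rewrite /ell_hat /mu_hat (ell_values_Ctilde alpha (grid_uniq n0 XI) im).
Qed.
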